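(* Let $m,m'\ge1$ be integers, let $R=\prod_{i=1}^mR_i$ and $R'=\prod_{j=1}^{m'}R'_j$ with $R_i=\mathrm{End}_{K_i}(U_i)$ and $R'_j=\mathrm{End}_{K'_j}(U'_j)$, where $U_i$, $U'_j$ are left vector spaces over (not necessarily commutative) fields $K_i$, $K'_j$, and $1\le\dim U_i<\infty$, $1\le\dim U'_j<\infty$ for all $i,j$. Let $\mathfrak M=(\mathcal G,\mathcal L)$ and $\mathfrak M'=(\mathcal G',\mathcal L')$ be the product spaces associated to $\mathbb P(R)$ and $\mathbb P(R')$, and let $\Psi:\mathbb P(R)\to\mathcal G$ and $\Psi':\mathbb P(R')\to\mathcal G'$ be the associated canonical bijections. For a mapping $\varphi:\mathbb P(R)\to\mathbb P(R')$ the following statements are equivalent: (a) $\varphi$ is a $\triangle$-isomorphism. (b) $\varphi$ is a $\sim$-isomorphism. (c) $\Psi^{-1}\varphi\Psi':\mathcal G\to\mathcal G'$ (mappings composed from left to right) is a collineation $\mathfrak M\to\mathfrak M'$.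
   Context: Rings are associative with unit $1\ne0$. Fields need not be commutative. Mappings are written on the right as exponents, and products of mappings (including products in endomorphism rings) are read from left to right. Projective line: $\mathbb P(R)$ is the set of all submodules $R(a,b)$ of the left module $R^2$ such that $(a,b)$ is the first row of a matrix in $\mathrm{GL}_2(R)$. Points $p,q\in\mathbb P(R)$ are distant, $p\,\triangle\,q$, if $p=R(a,b)$, $q=R(c,d)$ for some matrix $\begin{pmatrix}a&b\\c&d\end{pmatrix}\in\mathrm{GL}_2(R)$. Put $\triangle(p)=\{q\in\mathbb P(R)\mid q\,\triangle\,p\}$. Points $p,q$ are parallel, $p\parallel q$, if $\triangle(p)\subseteq\triangle(q)$ (known to be an equivalence relation). Points $p,q$ are adjacent, $p\sim q$, if there is $r\in\mathbb P(R)$ with $r\nparallel p$, $r\nparallel q$ and $\triangle(r)\subseteq\triangle(p)\cup\triangle(q)$. A $\triangle$-isomorphism (resp. $\sim$-isomorphism) $\mathbb P(R)\to\mathbb P(R')$ is a bijection preserving $\triangle$ (resp. $\sim$) in both directions. For $R=\prod_i R_i$, $\mathbb P(R)$ is identified with $\prod_i\mathbb P(R_i)$ by letting $R\big((a_i)_i,(b_i)_i\big)$ correspond to $\big(R_i(a_i,b_i)\big)_i$; $p_i$ denotes the $i$-th component of $p$. Grassmann spaces: for a left vector space $U$ over a field $K$ with $1\le n=\dim U<\infty$, the Grassmann space associated to $\mathbb P(\mathrm{End}_K(U))$ is the point-line geometry whose points are the $n$-dimensional subspaces of $U\times U$ and whose lines are the pencils $\{X \mid M\subset X\subset N,\ \dim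 X=n\}$ with $M\subset N\le U\times U$, $\dim M=n-1$, $\dim N=n+1$. The mapping sending $\mathrm{End}_K(U)(a,b)$ to $\{(u^a,u^b)\mid u\in U\}$ is a (known) well-defined bijection from $\mathbb P(\mathrm{End}_K(U))$ onto the point set of this Grassmann space. Direct (Segre) product of point-line geometries $\mathfrak M_i=(\mathcal P_i,\mathcal L_i)$, $i\in I$: points are the elements of $\prod_i\mathcal P_i$; lines are the sets $\{x\mid x_j\in L_j\text{ and }x_i=p_i\text{ for all }i\in I\setminus\{j\}\}$ with $j\in I$, $L_j\in\mathcal L_j$, $p\in\prod_i\mathcal P_i$. The product space associated to $\mathbb P(R)$, $R=\prod_i\mathrm{End}_{K_i}(U_i)$, is the Segre product $\mathfrak M=(\mathcal G,\mathcal L)$ of the Grassmann spaces $\mathfrak M_i$ associated to $\mathbb P(R_i)$, and $\Psi:\mathbb P(R)\to\mathcal G$ is the bijection $p\mapsto(p_i^{\Psi_i})_i$, where $\Psi_i$ is the bijection $R_i(a,b)\mapsto\{(u^a,u^b)\mid u\in U_i\}$ from $\mathbb P(R_i)$ to the point set of $\mathfrak M_i$. The product space $\mathfrak M'=(\mathcal G',\mathcal L')$ and the bijection $\Psi':\mathbb P(R')\to\mathcal G'$ are defined in the same way from $R'=\prod_j\mathrm{End}_{K'_j}(U'_j)$. A collineation is a bijection between point sets such that it and its inverse map lines onto lines. *)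

(* Defs.v *)
From HB Require Import structures.
From mathcomp Require Export all_boot all_fingroup all_algebra.
From mathcomp Require Export boolp classical_sets.

Set Implicit Arguments.
Unset Strict Implicit.
Unset Printing Implicit Defensive.

Import GRing.Theory.
Local Open Scope ring_scope.
Local Open Scope classical_set_scope.

Definition prodring (I : Type) (R : I -> pzRingType) : Type := forall i, R i.

Section ProdRing.
Variables (I : Type) (R : I -> pzRingType).
Implicit Types f g h : prodring R.

HB.instance Definition _ := Choice.copy (prodring R) (forall i, R i).

Definition prodring_zero : prodring R := fun=> 0.
Definition prodring_one : prodring R := fun=> 1.
Definition prodring_opp f : prodring R := fun i => - f i.
Definition prodring_add f g : prodring R := fun i => f i + g i.
Definition prodring_mul f g : prodring R := fun i => f i * g i.

Fact prodring_addA : associative prodring_add.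
Proof. by move=> f g h; apply: functional_extensionality_dep => i; apply: addrA. Qed.
Fact prodring_addC : commutative prodring_add.
Proof. by move=> f g; apply: functional_extensionality_dep => i; apply: addrC. Qed.
Fact prodring_add0 : left_id prodring_zero prodring_add.
Proof. by move=> f; apply: functional_extensionality_dep => i; apply: add0r. Qed.
Fact prodring_addN : left_inverse prodring_zero prodring_opp prodring_add.
Proof. by move=> f; apply: functional_extensionality_dep => i; apply: addNr. Qed.

HB.instance Definition _ := GRing.isZmodule.Build (prodring R)
  prodring_addA prodring_addC prodring_add0 prodring_addN.

Fact prodring_mulA : associative prodring_mul.
Proof. by move=> f g h; apply: functional_extensionality_dep => i; apply: mulrA. Qed.
Fact prodring_mul1l : left_id prodring_one prodring_mul.
Proof. by move=> f; apply: functional_extensionality_dep => i; apply: mul1r. Qed.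
Fact prodring_mul1r : right_id prodring_one prodring_mul.
Proof. by move=> f; apply: functional_extensionality_dep => i; apply: mulr1. Qed.
Fact prodring_mulDl : left_distributive prodring_mul prodring_add.
Proof. by move=> f g h; apply: functional_extensionality_dep => i; apply: mulrDl. Qed.
Fact prodring_mulDr : right_distributive prodring_mul prodring_add.
Proof. by move=> f g h; apply: functional_extensionality_dep => i; apply: mulrDr. Qed.

HB.instance Definition _ := GRing.Zmodule_isPzRing.Build (prodring R)
  prodring_mulA prodring_mul1l prodring_mul1r prodring_mulDl prodring_mulDr.

End ProdRing.

(* Products in endo U are read from left to right: (f * g) u = g (f u), see   *)
(* endo_mulE.                                                                 *)
Definition endo (K : nzRingType) (U : vectType K) : Type := 'End(U).

Section Endo.
Variables (K : nzRingType) (U : vectType K).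

HB.instance Definition _ := GRing.Zmodule.copy (endo U) 'End(U).

Definition endo_mul (f g : endo U) : endo U := (g \o f)%VF.

Fact endo_mulA : associative endo_mul.
Proof. by move=> f g h; rewrite /endo_mul comp_lfunA. Qed.
Fact endo_mul1l : left_id (\1%VF : endo U) endo_mul.
Proof. by move=> f; apply: comp_lfun1r. Qed.
Fact endo_mul1r : right_id (\1%VF : endo U) endo_mul.
Proof. by move=> f; apply: comp_lfun1l. Qed.
Fact endo_mulDl : left_distributive endo_mul +%R.
Proof. by move=> f g h; apply: comp_lfunDr. Qed.
Fact endo_mulDr : right_distributive endo_mul +%R.
Proof. by move=> f g h; apply: comp_lfunDl. Qed.

HB.instance Definition _ := GRing.Zmodule_isPzRing.Build (endo U)
  endo_mulA endo_mul1l endo_mul1r endo_mulDl endo_mulDr.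

Definition endo_fun (f : endo U) : U -> U := (f : 'End(U)).

Lemma endo_mulE (f g : endo U) u : endo_fun (f * g) u = endo_fun g (endo_fun f u).
Proof. exact: comp_lfunE. Qed.
Lemma endo_addE (f g : endo U) u : endo_fun (f + g) u = endo_fun f u + endo_fun g u.
Proof. exact: add_lfunE. Qed.
Lemma endo_1E u : endo_fun 1 u = u.
Proof. exact: id_lfunE. Qed.
Lemma endo_linear (f : endo U) : linear (endo_fun f).
Proof. exact: linearP. Qed.
Lemma endoP (f g : endo U) : endo_fun f =1 endo_fun g -> f = g.
Proof. by move=> fg; apply/lfunP. Qed.

End Endo.

Section ProjectiveLine.
Variable R : pzRingType.

(* unitmx is only available over commutative rings. *)
Definition GL2 (M : 'M[R]_2) : Prop :=
  exists N : 'M[R]_2, M *m N = 1%:M /\ N *m M = 1%:M.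

(* The left submodule R(a,b) of R^2, where v = (a,b). *)
Definition cyclic_submod (v : 'rV[R]_2) : set 'rV[R]_2 := range (fun r : R => r *: v).

Definition projline : Type :=
  {p : set 'rV[R]_2 | exists2 M, GL2 M & p = cyclic_submod (row 0 M)}.

Definition row_point (M : 'M[R]_2) (GM : GL2 M) : projline :=
  exist _ (cyclic_submod (row 0 M)) (ex_intro2 _ _ M GM erefl).

Definition distant (p q : projline) : Prop :=
  exists2 M, GL2 M &
    sval p = cyclic_submod (row 0 M) /\ sval q = cyclic_submod (row 1 M).

Definition distants (p : projline) : set projline := [set q | distant q p].

Definition parallel (p q : projline) : Prop := distants p `<=` distants q.

Definition adjacent (p q : projline) : Prop :=
  exists r : projline, [/\ ~ parallel r p, ~ parallel r q &
    distants r `<=` distants p `|` distants q].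

End ProjectiveLine.

Definition distant_isomorphism (R R' : pzRingType) (phi : projline R -> projline R') :=
  bijective phi /\ forall p q, distant p q <-> distant (phi p) (phi q).

Definition adjacent_isomorphism (R R' : pzRingType) (phi : projline R -> projline R') :=
  bijective phi /\ forall p q, adjacent p q <-> adjacent (phi p) (phi q).

Record geometry := Geometry { points : Type; lines : set (set points) }.

Definition collineation (M M' : geometry) (f : points M -> points M') : Prop :=
  exists g : points M' -> points M,
    [/\ cancel f g, cancel g f,
        forall L, lines L -> lines (f @` L) &
        forall L, lines L -> lines (g @` L)].

Definition segre (I : Type) (M : I -> geometry) : geometry :=
  {| points := forall i, points (M i);
     lines := [set l | exists (j : I) (L : set (points (M j))) (p : forall i, points (M i)),
       lines L /\
       l = [set x : forall i, points (M i) | L (x j) /\ forall i, i <> j -> x i = p i]] |}.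

(* S is an n-dimensional subspace: the span of n linearly independent vectors *)
(* ({vspace V} is only available over commutative fields).                    *)
Definition has_dim (K : nzRingType) (V : lmodType K) (S : set V) (n : nat) : Prop :=
  exists2 b : 'I_n -> V,
    forall c : 'I_n -> K, \sum_i c i *: b i = 0 -> forall i, c i = 0 &
    S = range (fun c : 'I_n -> K => \sum_i c i *: b i).

Definition grassmann (K : nzRingType) (U : vectType K) : geometry :=
  {| points := {X : set (U * U)%type | has_dim X (dim U)};
     lines := [set L | exists M N : set (U * U)%type,
       [/\ has_dim M (dim U).-1, has_dim N (dim U).+1, M `<=` N &
           L = [set X | M `<=` sval X /\ sval X `<=` N]]] |}.

Definition product_space (I : Type) (K : I -> nzRingType)
    (U : forall i, vectType (K i)) : geometry :=
  segre (fun i => grassmann (U i)).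

(* The canonical map from the projective line over End(U) to the Grassmann    *)
(* space. The set endo_graph (a,b) only depends on the submodule R(a,b); the  *)
(* map is defined as a union over the submodule to avoid choosing (a,b), see  *)
(* grass_setE.                                                                *)

Section Grass.
Variables (K : nzRingType) (U : vectType K).

Definition endo_graph (v : 'rV[endo U]_2) : set (U * U)%type :=
  range (fun u : U => (endo_fun (v 0 0) u, endo_fun (v 0 1) u)).

Definition grass_set (p : set 'rV[endo U]_2) : set (U * U)%type :=
  \bigcup_(v in p) endo_graph v.

Lemma grass_setE v : grass_set (cyclic_submod v) = endo_graph v.
Proof.
apply/seteqP; split=> [x [_ [r _ <-]] [u _ <-]|x vx].
  by exists (endo_fun r u) => //; rewrite !mxE !endo_mulE.
by exists v => //; exists 1 => //; rewrite scale1r.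
Qed.

End Grass.

Lemma sval_injective (T : Type) (P : T -> Prop) : injective (@proj1_sig T P).
Proof. by move=> [x Px] [y Py] /= xy; apply: eq_exist. Qed.

(* The identification of the projective line over a product of rings with     *)
(* the product of the projective lines: the i-th component of R(a,b) is the   *)
(* image of R(a,b) under the projection onto R_i^2, that is, R_i(a_i,b_i),    *)
(* see row_projE and component_setE.                                          *)

Section Components.
Variables (I : Type) (R : I -> pzRingType).

Definition proj i (f : prodring R) : R i := f i.

Fact proj_is_zmod i : zmod_morphism (@proj i). Proof. by []. Qed.
Fact proj_is_monoid i : monoid_morphism (@proj i). Proof. by []. Qed.
HB.instance Definition _ i := GRing.isZmodMorphism.Build _ _ (@proj i) (proj_is_zmod i).
HB.instance Definition _ i := GRing.isMonoidMorphism.Build _ _ (@proj i) (proj_is_monoid i).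

Definition row_proj (i : I) (v : 'rV[prodring R]_2) : 'rV[R i]_2 := map_mx (@proj i) v.

Definition component_set (i : I) (p : set 'rV[prodring R]_2) : set 'rV[R i]_2 :=
  row_proj i @` p.


Arguments row_proj i v : clear implicits.
Arguments component_set i p : clear implicits.

Lemma row_projE i v k : row_proj i v 0 k = (v 0 k) i.
Proof. by rewrite mxE. Qed.

Lemma component_setE i v : component_set i (cyclic_submod v) = cyclic_submod (row_proj i v).
Proof.
apply/seteqP; split=> [_ [_ [r _ <-] <-]|_ [r _ <-]].
  by exists (r i) => //; apply/rowP=> k; rewrite !mxE.
pose rr : prodring R := fun j => if pselect (i = j) is left e then ecast j (R j) e r else 0.
exists (rr *: v); first by exists rr.
apply/rowP=> k; rewrite !mxE /proj; congr (_ * _).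
by rewrite /rr; case: pselect => // e; rewrite (Prop_irrelevance e erefl).
Qed.

Lemma GL2_proj i (M : 'M[prodring R]_2) : GL2 M -> GL2 (map_mx (@proj i) M).
Proof.
move=> [N [MN NM]]; exists (map_mx (@proj i) N).
by rewrite -!map_mxM MN NM map_mx1.
Qed.

Fact component_subproof (p : projline (prodring R)) i :
  exists2 M, GL2 M & component_set i (sval p) = cyclic_submod (row 0 M).
Proof.
case: p => _ /= [M GM ->]; exists (map_mx (@proj i) M); first exact: GL2_proj.
by rewrite component_setE -map_row.
Qed.

Definition component (p : projline (prodring R)) i : projline (R i) :=
  exist _ _ (component_subproof p i).

Lemma component_inj (p q : projline (prodring R)) :
  (forall i, component p i = component q i) -> p = q.
Proof.
have sub (p' q' : projline (prodring R)) :
    (forall i, component p' i = component q' i) -> sval p' `<=` sval q'.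
  move=> pq; have {}pq i : component_set i (sval p') = component_set i (sval q').
    by have := congr1 sval (pq i).
  case: p' q' pq => [_ /= [M GM ->]] [_ /= [N GN ->]] pq _ [r _ <-].
  have ex i : {s : R i | s *: row_proj i (row 0 N) = r i *: row_proj i (row 0 M)}.
    apply: cid.
    have : component_set i (cyclic_submod (row 0 M)) (r i *: row_proj i (row 0 M)).
      by rewrite component_setE; exists (r i).
    by rewrite pq component_setE => -[s _ <-]; exists s.
  exists (fun i => sval (ex i)) => //.
  apply/rowP=> k; rewrite !mxE; apply: functional_extensionality_dep => i.
  by have /rowP/(_ k) := svalP (ex i); rewrite !mxE.
move=> pq; apply: sval_injective; apply/seteqP; split; first exact: sub.
by apply: sub => i; rewrite pq.
Qed.

Lemma component_surj (P : forall i, projline (R i)) :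
  exists p, forall i, component p i = P i.
Proof.
have ex i : {MN : 'M[R i]_2 * 'M[R i]_2 | [/\ MN.1 *m MN.2 = 1%:M,
    MN.2 *m MN.1 = 1%:M & sval (P i) = cyclic_submod (row 0 MN.1)]}.
  by apply: cid; case: (P i) => p /= [M [N [MN NM]] ->]; exists (M, N).
pose M : 'M[prodring R]_2 := \matrix_(k, l) (fun i => (sval (ex i)).1 k l).
pose N : 'M[prodring R]_2 := \matrix_(k, l) (fun i => (sval (ex i)).2 k l).
have Mi i : map_mx (@proj i) M = (sval (ex i)).1 by apply/matrixP=> k l; rewrite !mxE.
have Ni i : map_mx (@proj i) N = (sval (ex i)).2 by apply/matrixP=> k l; rewrite !mxE.
have mxext (A B : 'M[prodring R]_2) :
    (forall i, map_mx (@proj i) A = map_mx (@proj i) B) -> A = B.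
  move=> AB; apply/matrixP=> k l; apply: functional_extensionality_dep => i.
  by have /matrixP/(_ k l) := AB i; rewrite !mxE.
have GM : GL2 M.
  exists N; split; apply: mxext => i; rewrite map_mxM map_mx1 Mi Ni;
    by case: (svalP (ex i)).
exists (row_point GM) => i.
apply: sval_injective => /=; rewrite component_setE /row_proj map_row Mi.
by case: (svalP (ex i)).
Qed.

End Components.

Section GrassPoints.
Import VectorInternalTheory.

Lemma projlineP (R : pzRingType) (p : projline R) :
  exists v x y, sval p = cyclic_submod v /\ v 0 0 * x + v 0 1 * y = 1.
Proof.
case: p => p /= [M [N [MN _]] ->]; exists (row 0 M), (N 0 0), (N 1 0); split=> //.
have lift01 : lift ord0 ord0 = 1 :> 'I_2 by apply: val_inj.
have /matrixP/(_ 0 0) := MN.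
by rewrite !mxE eqxx mulr1n !big_ord_recl big_ord0 addr0 lift01 => <-.
Qed.

Variables (K : nzRingType) (U : vectType K).
Implicit Types v w : 'rV[endo U]_2.

Let endo_recover v x y (vxy : v 0 0 * x + v 0 1 * y = 1) u :
  endo_fun x (endo_fun (v 0 0) u) + endo_fun y (endo_fun (v 0 1) u) = u.
Proof. by rewrite -!endo_mulE -endo_addE vxy endo_1E. Qed.

Lemma endo_graph_dim v x y : v 0 0 * x + v 0 1 * y = 1 -> has_dim (endo_graph v) (dim U).
Proof.
move=> vxy.
pose gr u := (endo_fun (v 0 0) u, endo_fun (v 0 1) u).
have gr_lin (c : 'I_(dim U) -> K) (e : 'I_(dim U) -> U) :
    \sum_i c i *: gr (e i) = gr (\sum_i c i *: e i).
  rewrite /gr /endo_fun !linear_sum.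
  elim/big_rec3: _ => // i a b d _ ->.
  by rewrite !linearZ.
exists (fun i => gr (r2v (delta_mx 0 i))) => [c|].
  rewrite gr_lin => gr0 i.
  have : \sum_i c i *: r2v (delta_mx 0 i) = 0 :> U.
    set t := \sum_i _ in gr0 *; rewrite -(endo_recover vxy t).
    by case: gr0 => -> ->; rewrite /endo_fun !linear0 addr0.
  move/(congr1 (@v2r K U)); rewrite linear_sum linear0 => /rowP/(_ i).
  rewrite mxE summxE (bigD1 i) //= big1 => [|j ji].
    by rewrite linearZ /= r2vK !mxE !eqxx mulr1 addr0.
  by rewrite linearZ /= r2vK !mxE eqxx eq_sym (negPf ji) mulr0.
apply/seteqP; split=> [_ [u _ <-]|_ [c _ <-]]; last by rewrite gr_lin; exists (\sum_i c i *: r2v (delta_mx 0 i)).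
exists (v2r u 0) => //; rewrite gr_lin -[RHS]/(gr u); congr (gr _).
rewrite -[RHS]v2rK [v2r u in RHS]row_sum_delta linear_sum.
by apply: eq_bigr => i _; rewrite linearZ.
Qed.

Fact grass_point_subproof (p : projline (endo U)) : has_dim (grass_set (sval p)) (dim U).
Proof.
by have [v [x [y [-> /endo_graph_dim]]]] := projlineP p; rewrite grass_setE.
Qed.

Definition grass_point (p : projline (endo U)) : points (grassmann U) :=
  exist (fun X => has_dim X (dim U)) (grass_set (sval p)) (grass_point_subproof p).

Lemma grass_point_inj : injective grass_point.
Proof.
have sub v w x y : w 0 0 * x + w 0 1 * y = 1 -> endo_graph v = endo_graph w ->
    cyclic_submod v `<=` cyclic_submod w.
  move=> wxy vw _ [r _ <-].
  exists (r * (v 0 0 * x + v 0 1 * y)) => //; rewrite -scalerA; congr (_ *: _).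
  suff E k : (v 0 0 * x + v 0 1 * y) * w 0 k = v 0 k by apply/rowP=> k; rewrite mxE.
  apply: endoP => u.
  have [t _ tu] : endo_graph w (endo_fun (v 0 0) u, endo_fun (v 0 1) u) by rewrite -vw; exists u.
  rewrite endo_mulE endo_addE !endo_mulE; case: tu => t0 t1.
  rewrite -t0 -t1 (endo_recover wxy).
  have [->|->] // : k = 0 \/ k = 1.
  by case: k => [[|[|k]]] // k2; [left|right]; apply: val_inj.
move=> p q /(congr1 sval) /=.
have [v [x [y [pv vxy]]]] := projlineP p; have [w [z [t [qw wzt]]]] := projlineP q.
rewrite pv qw !grass_setE => vw; apply: sval_injective; rewrite pv qw.
by apply/seteqP; split; [apply: sub wzt vw | apply: sub vxy (esym vw)].
Qed.

End GrassPoints.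

(* Completion of linearly independent rows to an invertible matrix over a     *)
(* division ring, needed for the surjectivity of grass_point.                 *)
Section Completion.
Variable K : unitRingType.
Hypothesis K_div : GRing.field_axiom K.

Lemma row_reduction n (x : 'rV[K]_(1 + n)) : x != 0 ->
  exists P Q : 'M[K]_(1 + n), [/\ P *m Q = 1%:M, Q *m P = 1%:M & x *m P = row_mx 1%:M 0].
Proof.
move=> x0; have [j xj] : exists j, x 0 j != 0.
  apply/existsP; rewrite -negb_forall; apply: contra x0 => /forallP x0.
  by apply/eqP/rowP=> j; rewrite mxE; apply/eqP.
pose T : 'M[K]_(1 + n) := tperm_mx 0 j.
have TT : T *m T = 1%:M by rewrite /T /tperm_mx -perm_mxM tperm2 perm_mx1.
set x' := x *m T; pose a := x' 0 0; pose y := rsubmx x'.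
have aU : a \is a GRing.unit.
  by apply: K_div; rewrite /a /x' -xcolE !mxE tpermL.
have x'E : x' = row_mx a%:M y.
  rewrite -[LHS]hsubmxK [lsubmx x']mx11_scalar; congr (row_mx _%:M _).
  by rewrite /a mxE; congr (x' _ _); apply: val_inj.
pose P : 'M[K]_(1 + n) := block_mx a^-1%:M (- (a^-1 *: y)) 0 1%:M.
pose Q : 'M[K]_(1 + n) := block_mx a%:M y 0 1%:M.
exists (T *m P), (Q *m T); split.
- rewrite mulmxA -[T *m P *m Q]mulmxA mulmx_block !mulmx0 !mul0mx !mulmx1 !addr0 add0r.
  by rewrite -scalar_mxM mulVr // mul_scalar_mx subrr -scalar_mx_block mulmx1 TT.
- rewrite mulmxA -[Q *m T *m T]mulmxA TT mulmx1 mulmx_block !mulmx0 !mul0mx !mulmx1.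
  rewrite !addr0 add0r -scalar_mxM mulrV // mul_scalar_mx scalerN scalerA mulrV // scale1r.
  by rewrite addNr -scalar_mx_block.
- rewrite mulmxA -/x' x'E mul_row_block mulmx0 addr0 mulmx1 -scalar_mxM mulrV //.
  by rewrite mul_scalar_mx scalerN scalerA mulrV // scale1r addNr.
Qed.

Lemma free_completion k n (B : 'M[K]_(k, n)) : (forall c : 'rV_k, c *m B = 0 -> c = 0) ->
  (exists P Q : 'M[K]_n, [/\ P *m Q = 1%:M, Q *m P = 1%:M & B *m P = pid_mx k])
  /\ (k <= n)%N.
Proof.
elim: k n B => [|k IHk] [|n] B Bfree.
- by split=> //; exists 1%:M, 1%:M; rewrite !mulmx1; split=> //; apply/matrixP=> -[].
- by split=> //; exists 1%:M, 1%:M; rewrite !mulmx1; split=> //; apply/matrixP=> -[].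
- have /rowP/(_ 0)/eqP : const_mx 1 = 0 :> 'rV[K]_k.+1.
    by apply: Bfree; apply/rowP=> -[].
  by rewrite !mxE oner_eq0.
suff step (A : 'M[K]_(1 + k, 1 + n)) : (forall c : 'rV_(1 + k), c *m A = 0 -> c = 0) ->
    (exists P Q : 'M[K]_(1 + n), [/\ P *m Q = 1%:M, Q *m P = 1%:M & A *m P = pid_mx (1 + k)])
    /\ (1 + k <= 1 + n)%N by exact: step Bfree.
move: A => {}B {}Bfree.
have x0 : usubmx B != 0.
  apply/eqP=> B0; have /rowP/(_ 0)/eqP : row_mx 1%:M 0 = 0 :> 'rV[K]_(1 + k).
    by apply: Bfree; rewrite -[B]vsubmxK mul_row_col B0 mulmx0 mul0mx addr0.
  by rewrite !mxE; case: splitP => //= j _; rewrite !mxE ord1 eqxx oner_eq0.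
have [P1 [Q1 [PQ1 QP1 BP1]]] := row_reduction x0.
pose c := lsubmx (dsubmx B *m P1); pose B' := rsubmx (dsubmx B *m P1).
have BP1E : B *m P1 = block_mx 1%:M 0 c B'.
  by rewrite -[B in LHS]vsubmxK mul_col_mx BP1 -[dsubmx B *m P1]hsubmxK.
have B'free (d : 'rV_k) : d *m B' = 0 -> d = 0.
  move=> dB'; have /(congr1 rsubmx) : row_mx (- (d *m c)) d = 0 :> 'rV[K]_(1 + k).
    apply: Bfree; rewrite -[LHS]mulmx1 -PQ1 !mulmxA -[_ *m B *m P1]mulmxA BP1E.
    by rewrite mul_row_block mulmx1 mulmx0 dB' addNr addr0 row_mx0 mul0mx.
  by rewrite row_mxKr linear0.
have [[P' [Q' [PQ' QP' B'P']]] kn] := IHk _ _ B'free.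
pose P2 : 'M[K]_(1 + n) := block_mx 1%:M 0 0 P'.
pose Q2 : 'M[K]_(1 + n) := block_mx 1%:M 0 0 Q'.
have PQ2 : P2 *m Q2 = 1%:M.
  by rewrite mulmx_block !mulmx0 !mul0mx !mulmx1 !addr0 add0r PQ' -scalar_mx_block.
have QP2 : Q2 *m P2 = 1%:M.
  by rewrite mulmx_block !mulmx0 !mul0mx !mulmx1 !addr0 add0r QP' -scalar_mx_block.
pose E : 'M[K]_(n, 1) := pid_mx k *m c.
pose P3 : 'M[K]_(1 + n) := block_mx 1%:M 0 (- E) 1%:M.
pose Q3 : 'M[K]_(1 + n) := block_mx 1%:M 0 E 1%:M.
have PQ3 : P3 *m Q3 = 1%:M.
  by rewrite mulmx_block !mulmx0 !mul0mx !mulmx1 !mul1mx !addr0 !add0r addNr -scalar_mx_block.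
have QP3 : Q3 *m P3 = 1%:M.
  by rewrite mulmx_block !mulmx0 !mul0mx !mulmx1 !mul1mx !addr0 !add0r subrr -scalar_mx_block.
split=> //; exists (P1 *m P2 *m P3), (Q3 *m Q2 *m Q1); split.
- by rewrite !mulmxA -[_ *m P3 *m Q3]mulmxA PQ3 mulmx1 -[_ *m P2 *m Q2]mulmxA PQ2 mulmx1.
- by rewrite !mulmxA -[_ *m Q1 *m P1]mulmxA QP1 mulmx1 -[_ *m Q2 *m P2]mulmxA QP2 mulmx1.
rewrite !mulmxA BP1E mulmx_block !mulmx0 !mul0mx !mulmx1 !addr0 !add0r B'P'.
rewrite mulmx_block !mulmx0 !mul0mx !mulmx1 !addr0 !add0r mulmxN mulmxA pid_mx_id //.
rewrite pid_mx_1 mul1mx subrr -[RHS]submxK.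
by congr block_mx; apply/matrixP=> i j; rewrite !mxE ?ord1 ?eqxx /=.
Qed.

End Completion.

Section GrassSurjective.
Import VectorInternalTheory.
Variables (K : unitRingType) (U : vectType K).
Local Notation n := (dim U).

Let mk (A : 'M[K]_n) : endo U := Hom A.

Let mkE A u : endo_fun (mk A) u = r2v (v2r u *m A).
Proof. by rewrite /endo_fun unlock. Qed.
Let mkM A B : mk A * mk B = mk (A *m B).
Proof. by apply: endoP => u; rewrite endo_mulE !mkE r2vK mulmxA. Qed.
Let mkD A B : mk A + mk B = mk (A + B).
Proof. by apply: endoP => u; rewrite endo_addE !mkE mulmxDr linearD. Qed.
Let mk1 : mk 1%:M = 1.
Proof. by apply: endoP => u; rewrite mkE endo_1E mulmx1 v2rK. Qed.
Let mk0 : mk 0 = 0.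
Proof. by apply: endoP => u; rewrite mkE mulmx0 linear0 /endo_fun zero_lfunE. Qed.

Let toM (Q : 'M[K]_(n + n)) : 'M[endo U]_2 := \matrix_(k, l)
  mk (if k == 0 then if l == 0 then ulsubmx Q else ursubmx Q
      else if l == 0 then dlsubmx Q else drsubmx Q).

Let toM_mul P Q : toM P *m toM Q = toM (P *m Q).
Proof.
apply/matrixP=> k l; rewrite [LHS]mxE [RHS]mxE !big_ord_recl big_ord0 addr0 ![toM _ _ _]mxE /= !mkM mkD.
rewrite -{5 6 7 8}[P]submxK -{5 6 7 8}[Q]submxK mulmx_block.
rewrite block_mxKul block_mxKur block_mxKdl block_mxKdr.
by case: (k == 0); case: (l == 0).
Qed.

Let toM_1 : toM 1%:M = 1%:M.
Proof.
apply/matrixP=> k l; rewrite !mxE.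
rewrite !scalar_mx_block block_mxKul block_mxKur block_mxKdl block_mxKdr.
by case: k l => [[|[|k]] ?] [[|[|l]] ?]; rewrite //= ?mk1 ?mk0.
Qed.

Lemma grass_point_surj (X : points (grassmann U)) :
  GRing.field_axiom K -> exists p, grass_point p = X.
Proof.
move=> K_div; case: X => X /= [b bfree defX].
pose B : 'M[K]_(n, n + n) := \matrix_i row_mx (v2r (b i).1) (v2r (b i).2).
have BE (c : 'rV_n) : c *m B = row_mx (v2r (\sum_i c 0 i *: b i).1) (v2r (\sum_i c 0 i *: b i).2).
  rewrite mulmx_sum_row; under eq_bigr do rewrite rowK.
  elim/big_rec2: _ => [|i y t _ ->]; first by rewrite /= !linear0 row_mx0.
  by rewrite /= !linearD !linearZ scale_row_mx add_row_mx.
have Bfree (c : 'rV_n) : c *m B = 0 -> c = 0.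
  rewrite BE -row_mx0 => /eq_row_mx[/(congr1 r2v) e1 /(congr1 r2v) e2].
  rewrite !v2rK !linear0 in e1 e2.
  apply/rowP=> i; rewrite mxE; apply: (bfree (fun i => c 0 i)).
  by rewrite [LHS]surjective_pairing e1 e2.
have [[P [Q [PQ QP BP]]] _] := free_completion K_div Bfree.
have GQ : GL2 (toM Q) by exists (toM P); rewrite !toM_mul PQ QP toM_1.
have BQ : B = row_mx (ulsubmx Q) (ursubmx Q).
  rewrite -[LHS]mulmx1 -PQ mulmxA BP pid_mx_row -{1}[Q]submxK.
  by rewrite mul_row_block !mul1mx !mul0mx !addr0.
exists (row_point GQ); apply: sval_injective => /=; rewrite grass_setE defX.
have E u : (endo_fun (row 0 (toM Q) 0 0) u, endo_fun (row 0 (toM Q) 0 1) u)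
    = \sum_i v2r u 0 i *: b i.
  have := BE (v2r u); rewrite BQ mul_mx_row => /eq_row_mx[e1 e2].
  by rewrite !mxE !mkE /= e1 e2 !v2rK -surjective_pairing.
apply/seteqP; split=> [_ [u _ <-]|_ [c _ <-]]; first by exists (v2r u 0).
exists (r2v (\row_i c i)) => //; rewrite E r2vK.
by apply: eq_bigr => i _; rewrite mxE.
Qed.

End GrassSurjective.

Section Psi.
Variables (I : Type) (K : I -> unitRingType) (U : forall i, vectType (K i)).

(* On coordinates, Psi is described by Psi_row_point. *)
Definition Psi (p : projline (prodring (fun i => endo (U i)))) : points (product_space U) :=
  fun i => grass_point (component p i).

Lemma Psi_inj : injective Psi.
Proof.
move=> p q pq; apply: component_inj => i; apply: grass_point_inj.
by rewrite -[LHS]/(Psi p i) pq.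
Qed.

Lemma Psi_row_point M (GM : GL2 M) i :
  sval (Psi (row_point GM) i) = range (fun u : U i => (endo_fun (M 0 0 i) u, endo_fun (M 0 1 i) u)).
Proof. by rewrite /= component_setE grass_setE /endo_graph !row_projE !mxE. Qed.

Hypothesis K_div : forall i, GRing.field_axiom (K i).

Lemma Psi_surj X : exists p, Psi p = X.
Proof.
have ex i : {p | grass_point p = X i} by apply: cid; apply: grass_point_surj.
have [p pE] := component_surj (fun i => sval (ex i)).
exists p; apply: functional_extensionality_dep => i.
by rewrite /Psi pE; apply: svalP (ex i).
Qed.

Definition Psi_inv (X : points (product_space U)) : projline (prodring (fun i => endo (U i))) :=
  sval (cid (Psi_surj X)).

Lemma Psi_invK : cancel Psi_inv Psi.
Proof. by move=> X; apply: svalP (cid (Psi_surj X)). Qed.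

Lemma PsiK : cancel Psi Psi_inv.
Proof. by move=> p; apply: Psi_inj; rewrite Psi_invK. Qed.

End Psi.

(* Main.v *)
Require Import Defs.
From mathcomp Require Import zify.

(* Over a product of endomorphism rings, Psi turns "distant" into "complementary in every
   component". If every complement of r is a complement of p or of q, and r is neither p nor q,
   then p and q differ in one component only, and there they meet in dimension n - 1; conversely
   any third member r of the pencil of p and q has this property. Hence adjacency is collinearity
   of distinct points of the Segre product.
   Writing x ~= y for "adjacent or equal", the line through two distinct collinear points x, y is
   the set of all z such that z ~= w whenever w ~= x and w ~= y; so ~-isomorphisms are
   collineations. The distance of x and y in the collinearity graph is the sum over i of
   n_i - dim (x_i :&: y_i), and distant points are exactly those at maximal distance; so
   collineations preserve distant points. *)

Set Implicit Arguments.
Unset Strict Implicit.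
Unset Printing Implicit Defensive.

Import GRing.Theory.
Local Open Scope ring_scope.
Local Open Scope classical_set_scope.

(** * Dimension theory over a division ring *)

Section Subspaces.
Variables (K : unitRingType) (V : lmodType K).
Hypothesis K_div : GRing.field_axiom K.
Implicit Types (S T W Z : set V) (v x y : V).

Definition is_subspace S := S 0 /\ forall a x y, S x -> S y -> S (a *: x + y).

Definition addS S T : set V := [set x | exists2 s, S s & T (x - s)].

Definition adjoin S v : set V := [set x | exists a, S (x - a *: v)].

(** The default value [0] goes to sets without a finite basis; [has_dim_rk] shows that subspaces of
    a finite-dimensional space have one. *)
Definition rk S : nat := xget 0%N [set k | has_dim S k].

Lemma is_subspace0 S : is_subspace S -> S 0. Proof. by case. Qed.

Lemma is_subspaceZ S a x : is_subspace S -> S x -> S (a *: x).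
Proof. by move=> [S0 SP] Sx; rewrite -[_ *: _]addr0; apply: SP. Qed.

Lemma is_subspaceD S x y : is_subspace S -> S x -> S y -> S (x + y).
Proof. by move=> [S0 SP] Sx; rewrite -[x]scale1r; apply: SP. Qed.

Lemma is_subspaceN S x : is_subspace S -> S x -> S (- x).
Proof. by rewrite -scaleN1r; apply: is_subspaceZ. Qed.

Lemma is_subspaceB S x y : is_subspace S -> S x -> S y -> S (x - y).
Proof. by move=> hS Sx Sy; apply: is_subspaceD => //; apply: is_subspaceN. Qed.

Lemma is_subspaceZr S a x : is_subspace S -> a != 0 -> S (a *: x) -> S x.
Proof.
by move=> hS /K_div aU /(is_subspaceZ a^-1 hS); rewrite scalerA mulVr // scale1r.
Qed.

Lemma is_subspace_set0 : is_subspace [set 0].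
Proof. by split=> // a x y /= -> ->; rewrite scaler0 addr0. Qed.

Lemma is_subspaceT : is_subspace setT. Proof. by []. Qed.

Lemma is_subspaceI S T : is_subspace S -> is_subspace T -> is_subspace (S `&` T).
Proof. by move=> [S0 SP] [T0 TP]; split=> // a x y [? ?] [? ?]; split; auto. Qed.

Lemma is_subspace_addS S T : is_subspace S -> is_subspace T -> is_subspace (addS S T).
Proof.
move=> [S0 SP] [T0 TP]; split=> [|a x y [s Ss Ts] [t St Tt]].
  by exists 0; rewrite ?subr0.
exists (a *: s + t); first exact: SP.
by rewrite opprD addrACA -scalerBr; apply: TP.
Qed.

Lemma is_subspace_adjoin S v : is_subspace S -> is_subspace (adjoin S v).
Proof.
move=> [S0 SP]; split=> [|a x y [b Sb] [c Sc]].
  by exists 0; rewrite scale0r subr0.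
exists (a * b + c); rewrite scalerDl opprD addrACA -scalerA -scalerBr; exact: SP.
Qed.

Lemma sub_adjoin S v : S `<=` adjoin S v.
Proof. by move=> x Sx; exists 0; rewrite scale0r subr0. Qed.

Lemma mem_adjoin S v : is_subspace S -> adjoin S v v.
Proof. by move=> [S0 _]; exists 1; rewrite scale1r subrr. Qed.

Lemma adjoin_sub S T v : is_subspace T -> S `<=` T -> T v -> adjoin S v `<=` T.
Proof.
move=> hT ST Tv x [a /ST Tx]; rewrite -[x](subrK (a *: v)).
by apply: is_subspaceD => //; apply: is_subspaceZ.
Qed.

Lemma sub_addSl S T : is_subspace T -> S `<=` addS S T.
Proof. by move=> hT x Sx; exists x; rewrite // subrr; apply: is_subspace0. Qed.

Lemma sub_addSr S T : is_subspace S -> T `<=` addS S T.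
Proof. by move=> hS x Tx; exists 0; [apply: is_subspace0 | rewrite subr0]. Qed.

Lemma addS_sub S T W : is_subspace W -> S `<=` W -> T `<=` W -> addS S T `<=` W.
Proof.
move=> hW SW TW x [s /SW Ws /TW Wx]; rewrite -[x](subrKC s); exact: is_subspaceD.
Qed.

#[local] Hint Resolve is_subspace_set0 is_subspaceT is_subspaceI is_subspace_addS
  is_subspace_adjoin sub_adjoin mem_adjoin : core.

Lemma addS_adjoin S T v : is_subspace S -> is_subspace T ->
  addS (adjoin S v) T = adjoin (addS S T) v.
Proof.
move=> hS hT; apply/seteqP; split.
  apply: addS_sub; first by auto.
    apply: adjoin_sub; [by auto| |by auto].
    exact: subset_trans (sub_addSl hT) (@sub_adjoin _ v).
  exact: subset_trans (sub_addSr hS) (@sub_adjoin _ v).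
apply: adjoin_sub; first by auto.
  apply: addS_sub; [by auto| |by apply: sub_addSr; auto].
  exact: subset_trans (@sub_adjoin _ v) (sub_addSl hT).
by apply: sub_addSl; auto.
Qed.

Lemma has_dim_subspace S k : has_dim S k -> is_subspace S.
Proof.
move=> [b _ ->]; split=> [|a _ _ [c _ <-] [d _ <-]].
  by exists (fun=> 0) => //; rewrite big1 // => i _; rewrite scale0r.
exists (fun i => a * c i + d i) => //.
rewrite scaler_sumr -big_split; apply: eq_bigr => i _.
by rewrite scalerDl scalerA.
Qed.

Lemma has_dim_set0 : has_dim ([set 0] : set V) 0.
Proof.
exists (fun=> 0) => [c _ []//|]; apply/seteqP; split=> [_ ->|_ [c _ <-]].
  by exists (fun=> 0) => //; rewrite big_ord0.
by rewrite big_ord0.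
Qed.

(** The coordinates of a basis of [S] in one of [T] form a [k] by [l] matrix with trivial left
    kernel, and [free_completion] forces [k <= l]. *)
Lemma has_dim_le S T k l : has_dim S k -> has_dim T l -> S `<=` T -> (k <= l)%N.
Proof.
move=> [b bfree defS] [e _ defT] ST.
have ex i : {c : 'I_l -> K | \sum_j c j *: e j = b i}.
  apply: cid; have : T (b i).
    apply: ST; rewrite defS; exists (fun j => (j == i)%:R) => //.
    rewrite (bigD1 i) //= eqxx scale1r big1 ?addr0 // => j /negPf ->.
    by rewrite scale0r.
  by rewrite defT => -[c _ <-]; exists c.
pose C : 'M[K]_(k, l) := \matrix_(i, j) sval (ex i) j.
suff /(free_completion K_div) [] : forall c : 'rV_k, c *m C = 0 -> c = 0 by [].
move=> c cC; apply/rowP=> i; rewrite mxE; apply: (bfree (fun i => c 0 i)).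
under eq_bigr => j _ do rewrite -(svalP (ex j)) scaler_sumr.
rewrite exchange_big big1 //= => j _.
have /rowP/(_ j) := cC; rewrite !mxE => cCj.
rewrite -[RHS](scale0r (e j)) -cCj scaler_suml.
by apply: eq_bigr => h _; rewrite mxE scalerA.
Qed.

Lemma has_dim_adjoin S k v : has_dim S k -> ~ S v -> has_dim (adjoin S v) k.+1.
Proof.
move=> hS Sv; have sS := has_dim_subspace hS; case: hS => b bfree defS.
pose e (i : 'I_k.+1) := if unlift ord0 i is Some j then b j else v.
have eE (c : 'I_k.+1 -> K) :
    \sum_i c i *: e i = c ord0 *: v + \sum_j c (lift ord0 j) *: b j.
  rewrite big_ord_recl {1}/e unlift_none; congr (_ + _).
  by apply: eq_bigr => j _; rewrite /e liftK.
have Sb (c : 'I_k -> K) : S (\sum_j c j *: b j) by rewrite defS; exists c.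
exists e => [c|].
  rewrite eE => ce0.
  (* A nonzero coefficient of [v] could be inverted, which would put [v] into [S]. *)
  have c0 : c ord0 = 0.
    apply/eqP; apply: contrapT => /negP c0; apply: Sv; apply: (is_subspaceZr sS c0).
    by rewrite -[X in S X]opprK (addr0_eq ce0); apply: is_subspaceN => //; apply: Sb.
  move: ce0; rewrite c0 scale0r add0r => /bfree cl i.
  by case: (unliftP ord0 i) => [j|] ->.
apply/seteqP; split=> [x [a]|_ [c _ <-]].
  rewrite defS => -[c _ cE].
  exists (fun i => if unlift ord0 i is Some j then c j else a) => //.
  rewrite eE unlift_none; under eq_bigr do rewrite liftK.
  by rewrite cE subrKC.
by rewrite eE; exists (c ord0); rewrite addrC addKr.
Qed.

(** * The rank function of a finite-dimensional space *)

Variable N : nat.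
Hypothesis V_dim : has_dim (setT : set V) N.

Lemma has_dim_uniq S k l : has_dim S k -> has_dim S l -> k = l.
Proof.
move=> hk hl; apply/eqP; rewrite eqn_leq; apply/andP.
by split; [apply: has_dim_le hk hl _ | apply: has_dim_le hl hk _].
Qed.

Lemma has_dim_rkE S k : has_dim S k -> rk S = k.
Proof. by move=> hk; apply: has_dim_uniq (hk); apply: (xgetI 0%N hk). Qed.

(** Dimensions of subspaces inside [S] are bounded by [N]. One of maximal dimension is [S] itself,
    since any missing vector could be adjoined. *)
Lemma has_dim_rk S : is_subspace S -> has_dim S (rk S).
Proof.
move=> hS; suff [k hk] : exists k, has_dim S k by rewrite (has_dim_rkE hk).
pose P k := `[< exists2 W, has_dim W k & W `<=` S >].
have exP : exists k, P k.
  by exists 0%N; apply/asboolP; exists [set 0]; [apply: has_dim_set0 | move=> _ ->; case: hS].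
have bP k : P k -> (k <= N)%N.
  by move=> /asboolP[W hW _]; apply: has_dim_le hW V_dim _.
case: (ex_maxnP exP bP) => k /asboolP[W hW WS] kmax; exists k.
suff <- : W = S by [].
apply/seteqP; split=> // v Sv; apply: contrapT => Wv.
have /kmax : P k.+1; last by rewrite ltnn.
apply/asboolP; exists (adjoin W v); first exact: has_dim_adjoin.
exact: adjoin_sub.
Qed.

Lemma rk_sub S T : is_subspace S -> is_subspace T -> S `<=` T -> (rk S <= rk T)%N.
Proof. by move=> hS hT; apply: has_dim_le; apply: has_dim_rk. Qed.

Lemma rk_adjoin S v : is_subspace S -> ~ S v -> rk (adjoin S v) = (rk S).+1.
Proof. by move=> hS Sv; apply: has_dim_rkE; apply: has_dim_adjoin => //; apply: has_dim_rk. Qed.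

Lemma rk_sub_eq S T : is_subspace S -> is_subspace T -> S `<=` T -> (rk T <= rk S)%N -> T `<=` S.
Proof.
move=> hS hT ST TS v Tv; apply: contrapT => Sv.
have := rk_sub (is_subspace_adjoin v hS) hT (adjoin_sub hT ST Tv).
by rewrite rk_adjoin //; lia.
Qed.

Lemma rk0 : rk [set 0] = 0%N. Proof. exact: has_dim_rkE has_dim_set0. Qed.

Lemma rkT : rk setT = N. Proof. exact: has_dim_rkE. Qed.

Lemma rk_gt0P S : is_subspace S -> (0 < rk S)%N -> exists2 v, S v & v <> 0.
Proof.
move=> hS S0; apply: contrapT => /forall2NP Sv.
have : (rk S <= rk [set 0%R])%N.
  apply: rk_sub => //.
  by move=> v Sv0; case: (Sv v) => // /contrapT.
by rewrite rk0; lia.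
Qed.

Lemma rk_eq0 S : is_subspace S -> rk S = 0%N <-> S `<=` [set 0].
Proof.
move=> hS; split=> [S0 v Sv|S0].
  apply: (rk_sub_eq is_subspace_set0 hS _ _ Sv); last by rewrite S0.
  by move=> _ ->; case: hS.
by apply/eqP; rewrite -leqn0 -rk0; apply: rk_sub.
Qed.

(** Each adjoined vector lowers [rk T - rk W], so the chain reaches [T]. This does the work of
    extending a basis of [S] to one of [T]. *)
Lemma adjoin_ind (P : set V -> Prop) S T : is_subspace S -> is_subspace T -> S `<=` T -> P S ->
  (forall W v, is_subspace W -> S `<=` W -> W `<=` T -> T v -> ~ W v -> P W -> P (adjoin W v)) ->
  P T.
Proof.
move=> hS hT ST PS step.
suff: forall k W, (rk T - rk W <= k)%N -> is_subspace W -> S `<=` W -> W `<=` T -> P W -> P T.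
  by move/(_ (rk T - rk S)%N S); apply.
elim=> [|k IHk] W Wk hW SW WT PW.
  suff <- : W = T by [].
  by apply/seteqP; split=> //; apply: rk_sub_eq => //; lia.
have [TW|/existsNP[v /not_implyP[Tv Wv]]] := pselect (T `<=` W).
  by suff <- : W = T by []; apply/seteqP; split.
apply: (IHk (adjoin W v)); last exact: step.
- by rewrite rk_adjoin //; lia.
- exact: is_subspace_adjoin.
- exact: subset_trans (@sub_adjoin W v).
- exact: adjoin_sub.
Qed.

Lemma rk_between S T k : is_subspace S -> is_subspace T -> S `<=` T -> (rk S <= k <= rk T)%N ->
  exists W, [/\ is_subspace W, S `<=` W, W `<=` T & rk W = k].
Proof.
move=> hS hT ST; apply: (@adjoin_ind (fun T => (rk S <= k <= rk T)%N -> _) S T) => //.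
  by move=> kS; exists S; split=> //; lia.
move=> W v hW SW WT Tv Wv IHW; rewrite rk_adjoin // => kW.
have [kW'|kW'] := leqP k (rk W).
  case: IHW => [|W' [hW' SW' W'W rW']]; first lia.
  exists W'; split=> //; exact: subset_trans (@sub_adjoin W v).
exists (adjoin W v); split=> //; first exact: is_subspace_adjoin.
- exact: subset_trans (@sub_adjoin W v).
- by rewrite rk_adjoin //; lia.
Qed.

(** Along a chain from the meet of [S] and [T] up to [S], each adjoined vector raises both sides by
    one. *)
Lemma rk_modular S T : is_subspace S -> is_subspace T ->
  (rk (addS S T) + rk (S `&` T) = rk S + rk T)%N.
Proof.
move=> hS hT; have hD := is_subspaceI hS hT.
apply: (@adjoin_ind (fun W => (rk (addS W T) + rk (S `&` T) = rk W + rk T)%N) _ _ hD hS).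
- exact: subIsetl.
- suff -> : addS (S `&` T) T = T by rewrite addnC.
  apply/seteqP; split; last exact: sub_addSr.
  by apply: addS_sub => //; apply: subIsetr.
move=> W v hW DW WS Sv Wv IH.
rewrite addS_adjoin //.
rewrite !rk_adjoin //; first by move: IH; lia.
- exact: is_subspace_addS.
(* If [v = s + t] with [s] in [W] and [t] in [T], then [t = v - s] lies in [S] and in [T], hence in
   [W], and so does [v]. *)
move=> [s Ws Tvs]; apply: Wv; rewrite -[v](subrKC s); apply: is_subspaceD => //.
by apply: DW; split=> //; apply: is_subspaceB => //; apply: WS.
Qed.

(** Along a chain from [Z0 + S] to [T], each vector adjoined to [Z + S] is adjoined to [Z] as
    well. *)
Lemma rk_complement S T Z0 : is_subspace S -> is_subspace T -> is_subspace Z0 ->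
  S `<=` T -> Z0 `<=` T -> Z0 `&` S `<=` [set 0] ->
  exists Z, [/\ is_subspace Z, Z0 `<=` Z, Z `<=` T, Z `&` S `<=` [set 0] & (rk Z + rk S = rk T)%N].
Proof.
move=> hS hT hZ ST ZT ZS0.
have hA := is_subspace_addS hZ hS.
have [] := @adjoin_ind (fun W => exists Z, [/\ is_subspace Z, Z0 `<=` Z, Z `&` S `<=` [set 0] &
  addS Z S = W]) _ _ hA hT.
- exact: addS_sub.
- by exists Z0; split.
- move=> W v hW AW WT Tv Wv [Z [hZ1 Z01 ZS ZSW]].
  have hZ' := is_subspace_adjoin v hZ1.
  exists (adjoin Z v); split=> //.
  + exact: subset_trans (@sub_adjoin _ v).
  + move=> x [[a Zx] Sx]; apply: ZS; split=> //.
    (* A nonzero coefficient [a] would put [v] into [Z + S = W]. *)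
    have [a0|a0] := boolP (a == 0); first by move: Zx; rewrite (eqP a0) scale0r subr0.
    case: Wv; apply: (is_subspaceZr hW a0).
    rewrite -ZSW; exists (- (x - a *: v)); first exact: is_subspaceN.
    by rewrite opprK subrKC.
  + by rewrite addS_adjoin // ZSW.
move=> Z [hZ1 Z01 ZS ZST]; exists Z; split=> //; first by rewrite -ZST; apply: sub_addSl.
rewrite -ZST -rk_modular //.
by move/rk_eq0: (ZS) => ->; rewrite ?addn0 //; auto.
Qed.

Lemma disjoint_adjoin0 S v : is_subspace S -> ~ S v -> adjoin [set 0] v `&` S `<=` [set 0].
Proof.
move=> hS Sv x [[a /subr0_eq ->] Sav] /=; have [->|a0] := eqVneq a 0; first exact: scale0r.
by case: Sv; apply: is_subspaceZr Sav.
Qed.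

(** * Half-dimensional subspaces: complements and closeness *)

Variable n : nat.
Hypothesis n_gt0 : (0 < n)%N.
Hypothesis N_double : N = (n + n)%N.

Definition halfspace S := is_subspace S /\ rk S = n.

(** The successor avoids subtraction. For half-dimensional subspaces this means equal or meeting in
    rank [n - 1]. *)
Definition close S T := (n <= (rk (S `&` T)).+1)%N.

Lemma halfspace_eq S T : halfspace S -> halfspace T -> S `<=` T -> S = T.
Proof.
by move=> [hS rS] [hT rT] ST; apply/seteqP; split=> //; apply: rk_sub_eq; rewrite ?rS ?rT.
Qed.

Lemma halfspace_nsub S T : halfspace S -> halfspace T -> S <> T -> exists2 v, S v & ~ T v.
Proof.
move=> hS hT neST; apply: contrapT => /forall2NP ST; apply: neST; apply: halfspace_eq => // v Sv.
by case: (ST v) => // /contrapT.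
Qed.

Lemma rk_meet_lt S T : halfspace S -> halfspace T -> S <> T -> (rk (S `&` T) < n)%N.
Proof.
move=> hS hT neST; rewrite ltnNge; apply/negP => nST; apply: neST.
have [[sS rS] [sT rT]] := (hS, hT); apply: halfspace_eq => //.
apply: subset_trans (@subIsetr _ S T); by apply: rk_sub_eq; rewrite ?rS; auto.
Qed.

Lemma closeC S T : close S T = close T S.
Proof. by rewrite /close setIC. Qed.

Lemma close_refl S : halfspace S -> close S S.
Proof. by rewrite /close setIid => -[_ ->]. Qed.

Lemma exists_disjoint_halfspace S Z0 : halfspace S -> is_subspace Z0 -> Z0 `&` S `<=` [set 0] ->
  exists Z, [/\ halfspace Z, Z0 `<=` Z & Z `&` S `<=` [set 0]].
Proof.
move=> [hS rS] hZ0 Z0S.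
have [Z [hZ Z0Z _ ZS]] :=
  rk_complement hS is_subspaceT hZ0 (@subsetT _ S) (@subsetT _ Z0) Z0S.
by rewrite rS rkT => rZ; exists Z; split=> //; split=> //; lia.
Qed.

(** A vector of [T] outside [S] extends to a complement of [S], which then meets [T]. *)
Lemma exists_separating_halfspace S T : halfspace S -> halfspace T -> S <> T ->
  exists Z, [/\ halfspace Z, Z `&` S `<=` [set 0] & ~ Z `&` T `<=` [set 0]].
Proof.
move=> hS hT neST.
have [|t Tt St] := halfspace_nsub hT hS; [by move=> TS; apply: neST|].
have [Z [hZ tZ ZS]] := exists_disjoint_halfspace hS (is_subspace_adjoin t is_subspace_set0)
  (disjoint_adjoin0 (proj1 hS) St).
exists Z; split=> // /(_ t) t0; apply: St; rewrite t0; first exact: is_subspace0 (proj1 hS).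
by split=> //; apply: tZ; apply: mem_adjoin.
Qed.

(** Take [a] in [P] and [b] in [Q], both outside [S]. Their span must meet [S], otherwise a
    complement of [S] through both would meet [P] and [Q]. So [a] and [b] are proportional modulo
    [S], and [P + Q] lies in [S] extended by one vector; the modular law then bounds the meet of [P]
    and [Q] from below. *)
Lemma cover_close P Q S : halfspace P -> halfspace Q -> halfspace S -> S <> P -> S <> Q ->
  (forall Z, halfspace Z -> Z `&` S `<=` [set 0] -> Z `&` P `<=` [set 0] \/ Z `&` Q `<=` [set 0]) ->
  P <> Q /\ close P Q.
Proof.
move=> hP hQ hS nSP nSQ cov.
have [[sP rP] [sQ rQ] [sS rS]] := And3 hP hQ hS.
have [|a Pa Sa] := halfspace_nsub hP hS; [by move=> PS; apply: nSP|].
have [|b Qb Sb] := halfspace_nsub hQ hS; [by move=> QS; apply: nSQ|].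
have S0 : S 0 := is_subspace0 sS.
(* The vectors [c] and [d] may coincide; that case yields [P <> Q] below. *)
have nocov W c d : is_subspace W -> W c -> P c -> ~ S c -> W d -> Q d -> ~ S d ->
    ~ W `&` S `<=` [set 0].
  move=> hW Wc Pc Sc Wd Qd Sd /(exists_disjoint_halfspace hS hW)[Z [hZ WZ ZS]].
  case: (cov Z hZ ZS) => [/(_ c)|/(_ d)] z0.
    by apply: Sc; rewrite z0 //; split=> //; apply: WZ.
  by apply: Sd; rewrite z0 //; split=> //; apply: WZ.
have key c d : P c -> ~ S c -> Q d -> ~ S d -> adjoin S c d /\ adjoin S d c.
  move=> Pc Sc Qd Sd; pose W := adjoin (adjoin [set 0] c) d.
  have hW : is_subspace W by rewrite /W; auto.
  have Wc : W c by apply: sub_adjoin; apply: mem_adjoin.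
  have Wd : W d by apply: mem_adjoin; auto.
  have /existsNP[x /not_implyP[[[t [s /subr0_eq xE]] Sx] x0]] := nocov W c d hW Wc Pc Sc Wd Qd Sd.
  (* The nonzero vector [x = t d + s c] lies in [S]; if [t] or [s] vanished, [c] or [d] would lie in
     [S]. *)
  have t0 : t != 0.
    apply/eqP=> t0; move: xE; rewrite t0 scale0r subr0 => xE.
    have [s0|s0] := eqVneq s 0; first by apply: x0; rewrite /= xE s0 scale0r.
    by apply: Sc; apply: (is_subspaceZr sS s0); rewrite -xE.
  have s0 : s != 0.
    apply/eqP=> s0; move: xE; rewrite s0 scale0r => /subr0_eq xE.
    by apply: Sd; apply: (is_subspaceZr sS t0); rewrite -xE.
  split; [apply: (is_subspaceZr _ t0)|apply: (is_subspaceZr _ s0)]; auto.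
    have -> : t *: d = x - s *: c by rewrite -xE subKr.
    apply: is_subspaceB; [by auto|exact: sub_adjoin|].
    by apply: is_subspaceZ; auto.
  rewrite -xE; apply: is_subspaceB; [by auto|exact: sub_adjoin|].
  by apply: is_subspaceZ; auto.
split.
  move=> PQ; have Qa : Q a by rewrite -PQ.
  apply: (nocov (adjoin [set 0] a) a a) => //; [by auto|by auto|by auto|].
  exact: disjoint_adjoin0.
have PQa : addS P Q `<=` adjoin S a.
  (* [key] only compares vectors of [P] with vectors of [Q], so a vector of [P] is compared with [a]
     by way of [b]. *)
  apply: addS_sub; [by auto| |] => x hx; have [Sx|Sx] := pselect (S x); try exact: sub_adjoin.
    have [_ xb] := key _ _ hx Sx Qb Sb.
    apply: adjoin_sub xb; [by auto|exact: sub_adjoin|].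
    by case: (key _ _ Pa Sa Qb Sb).
  by case: (key _ _ Pa Sa hx Sx).
have := rk_sub (is_subspace_addS sP sQ) (is_subspace_adjoin a sS) PQa.
have := rk_modular sP sQ.
by rewrite rk_adjoin // /close rP rQ rS; lia.
Qed.

Lemma close_rk S T : halfspace S -> halfspace T -> S <> T -> close S T ->
  rk (S `&` T) = n.-1 /\ rk (addS S T) = n.+1.
Proof.
move=> hS hT neST; have := rk_meet_lt hS hT neST; rewrite /close.
by have := rk_modular (proj1 hS) (proj1 hT); rewrite (proj2 hS) (proj2 hT); lia.
Qed.

(** A complement [Z] of the third member [S] meets [P + Q] in rank at most one. If it met both [P]
    and [Q], it would do so in the same line, which then lies in [S]. *)
Lemma close_cover P Q : halfspace P -> halfspace Q -> P <> Q -> close P Q ->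
  exists S, [/\ halfspace S, S <> P, S <> Q & forall Z, halfspace Z ->
    Z `&` S `<=` [set 0] -> Z `&` P `<=` [set 0] \/ Z `&` Q `<=` [set 0]].
Proof.
move=> hP hQ nPQ cPQ; have [rM rN] := close_rk hP hQ nPQ cPQ.
have [[sP rP] [sQ rQ]] := (hP, hQ).
have [a Pa Qa] := halfspace_nsub hP hQ nPQ.
have [|b Qb Pb] := halfspace_nsub hQ hP; [by move=> QP; apply: nPQ|].
pose M := P `&` Q; have sM : is_subspace M by rewrite /M; auto.
have Pab : ~ P (a + b) by move=> Pab; apply: Pb; rewrite -[b](addKr a) addrC; apply: is_subspaceB.
have Qab : ~ Q (a + b) by move=> Qab; apply: Qa; rewrite -[a](addrK b); apply: is_subspaceB.
(* A third member of the pencil: [a + b] lies in [P + Q], but neither in [P] nor in [Q]. *)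
pose S := adjoin M (a + b); have sS : is_subspace S by rewrite /S; auto.
have Sab : S (a + b) by apply: mem_adjoin.
have rS : rk S = n by rewrite rk_adjoin // ?rM ?prednK // => -[].
have MS : M `<=` S by apply: sub_adjoin.
exists S; split=> //.
- by move=> SP; apply: Pab; rewrite -SP.
- by move=> SQ; apply: Qab; rewrite -SQ.
move=> Z [sZ rZ] ZS; apply: contrapT => /not_orP[].
move=> /existsNP[x /not_implyP[[Zx Px] x0]] /existsNP[y /not_implyP[[Zy Qy] y0]].
pose W := Z `&` addS P Q; have sN : is_subspace (addS P Q) by auto.
have sW : is_subspace W by rewrite /W; auto.
have PN : P `<=` addS P Q by apply: sub_addSl.
have QN : Q `<=` addS P Q by apply: sub_addSr.
have SN : S `<=` addS P Q.
  apply: adjoin_sub => //; first by move=> z [/PN].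
  by apply: is_subspaceD; auto.
have rW : (rk W <= 1)%N.
  have := rk_modular sW sS.
  have -> : rk (W `&` S) = 0%N by apply/rk_eq0; [auto|move=> z [[Zz _] Sz]; apply: ZS].
  have := rk_sub (is_subspace_addS sW sS) sN (addS_sub sN (@subIsetr _ _ _) SN).
  by rewrite rN rS; lia.
(* The meet of [W] and [P] contains the nonzero [x], so it has rank one and fills [W]. *)
have WP : W `<=` W `&` P.
  apply: rk_sub_eq; [by auto|by auto|exact: subIsetl|].
  apply: leq_trans rW _; rewrite lt0n; apply/eqP => /rk_eq0 WP0.
  by apply: x0; apply: WP0; [auto|split=> //; split=> //; apply: PN].
have [_ Py] : (W `&` P) y by apply: WP; split=> //; apply: QN.
by apply: y0; apply: ZS; split=> //; apply: MS.
Qed.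

Lemma between_close M S T : halfspace S -> halfspace T -> is_subspace M -> rk M = n.-1 ->
  M `<=` S -> M `<=` T -> close S T.
Proof.
move=> [sS rS] [sT rT] sM rM MS MT; rewrite /close.
have : (rk M <= rk (S `&` T))%N.
  by apply: rk_sub; [by []|by auto|move=> x Mx; split; auto].
by rewrite rM; lia.
Qed.

Lemma between_close_dual N' S T : halfspace S -> halfspace T -> is_subspace N' -> rk N' = n.+1 ->
  S `<=` N' -> T `<=` N' -> close S T.
Proof.
move=> [sS rS] [sT rT] sN rN SN TN; rewrite /close.
have := rk_sub (is_subspace_addS sS sT) sN (addS_sub sN SN TN).
by have := rk_modular sS sT; rewrite rN rS rT; lia.
Qed.

(** * Pencils recovered from closeness *)

Section Pencil.
Variables M N' : set V.
Hypotheses (sM : is_subspace M) (sN : is_subspace N').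
Hypotheses (rM : rk M = n.-1) (rN : rk N' = n.+1).

Let pencil S := M `<=` S /\ S `<=` N'.

(** [S] and [T] meet exactly in [M]. Either [W] meets [S] inside [T], and this meet is [M] by rank;
    or some [w] in [W] and [S] lies outside [T], and [W] is spanned by [w] and its meet with [T],
    both inside [N']. *)
Lemma close_pencil S T W : halfspace S -> halfspace T -> halfspace W -> S <> T ->
  pencil S -> pencil T -> close W S -> close W T -> M `<=` W \/ W `<=` N'.
Proof.
move=> hS hT hW neST [MS SN] [MT TN] cS cT.
have [[sS rS] [sT rT] [sW rW]] := And3 hS hT hW.
have [rST _] := close_rk hS hT neST (between_close hS hT sM rM MS MT).
have MST : S `&` T `<=` M.
  apply: rk_sub_eq; [by []|by auto|by move=> x Mx; split; auto|by rewrite rM rST].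
have [WST|/existsNP[w /not_implyP[[Ww Sw] Tw]]] := pselect (W `&` S `<=` T).
  left; apply: subset_trans (@subIsetl _ W S).
  apply: rk_sub_eq; [by auto|by []|by move=> x [Wx Sx]; apply: MST; split=> //; apply: WST|].
  by move: cS; rewrite /close rM; lia.
right; have sWT : is_subspace (W `&` T) by auto.
have AN : adjoin (W `&` T) w `<=` N'.
  by apply: adjoin_sub => //; [move=> x [_ /TN]|apply: SN].
apply: subset_trans AN; apply: rk_sub_eq; [by auto|by []| |].
  by apply: adjoin_sub => // x [].
rewrite rk_adjoin //; last by case.
by move: cT; rewrite /close rW.
Qed.

Lemma pencil_close S W : halfspace S -> halfspace W -> pencil S ->
  M `<=` W \/ W `<=` N' -> close W S.
Proof.
move=> hS hW [MS SN] [MW|WN]; first exact: (between_close hW hS sM).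
exact: (between_close_dual hW hS sN).
Qed.

(** By [close_pencil], the test subspaces [W] are those containing [M] or contained in [N']. Applied
    to [S] and [T], the condition gives one of the two inclusions for [Z]; a suitable [W] then
    refutes failure of the other. *)
Lemma pencilP S T Z : halfspace S -> halfspace T -> halfspace Z -> S <> T -> M `<=` N' ->
  pencil S -> pencil T ->
  (pencil Z <-> forall W, halfspace W -> close W S -> close W T -> close Z W).
Proof.
move=> hS hT hZ neST MN pS pT; split=> [pZ W hW WS WT|ZW].
  by rewrite closeC; apply: pencil_close => //; apply: close_pencil WS WT.
have [sZ rZ] := hZ.
have pW W : halfspace W -> M `<=` W \/ W `<=` N' -> close Z W.
  by move=> hW MWN; apply: ZW => //; apply: pencil_close.
have cS : close Z S by apply: pW => //; left; case: pS.
have cT : close Z T by apply: pW => //; left; case: pT.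
have [MZ|ZN] := close_pencil hS hT hZ neST pS pT cS cT; split=> //; apply: contrapT => nsub.
  have M0 : (0 < rk M)%N.
    (* For [n = 1] the subspace [N'] is the whole space and contains [Z]. *)
    rewrite rM; have [n1|] := eqVneq n 1%N; last by lia.
    case: nsub; suff TN : setT `<=` N' by apply: subset_trans TN.
    by apply: rk_sub_eq => //; rewrite rN rkT; lia.
  have ZNM : Z `&` N' `<=` M.
    apply: rk_sub_eq; [by []|by auto|by move=> x Mx; split; auto|].
    have : (rk (Z `&` N') < n)%N; last by rewrite rM; lia.
    rewrite ltnNge -rZ; apply/negP => ZN; apply: nsub.
    apply: subset_trans (@subIsetr _ Z N').
    by apply: rk_sub_eq ZN; [auto|auto|apply: subIsetl].
  have [m Mm m0] := rk_gt0P sM M0.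
  have sm : is_subspace (adjoin [set 0] m) by auto.
  have rm : rk (adjoin [set 0] m) = 1%N by rewrite rk_adjoin // rk0.
  (* [W] is a complement in [N'] of a line of [M]. Since [Z] meets [N'] in [M], it meets [W] in rank
     below [n - 1]. *)
  have [|||W [sW _ WN Wm]] := @rk_complement (adjoin [set 0] m) N' [set 0] sm sN is_subspace_set0.
  - apply: adjoin_sub => //; [by move=> _ ->; apply: is_subspace0|exact: MN].
  - by move=> _ ->; apply: is_subspace0.
  - by move=> x [].
  rewrite rm rN => rW; have hW : halfspace W by split=> //; lia.
  have : close Z W by apply: pW => //; right.
  have MW : ~ M `<=` M `&` W.
    move=> /(_ _ Mm)[_ Wm']; apply: m0; apply: Wm; split=> //.
    exact: mem_adjoin.
  have : (rk (Z `&` W) <= rk (M `&` W))%N.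
    apply: rk_sub; [by auto|by auto|]; move=> x [Zx Wx]; split=> //; apply: ZNM.
    by split=> //; apply: WN.
  have : (rk (M `&` W) < rk M)%N.
    rewrite ltnNge; apply/negP => rMW; apply: MW.
    by apply: rk_sub_eq rMW; [auto|auto|apply: subIsetl].
  by rewrite /close rM; lia.
have [v NVv] : exists v, ~ N' v.
  (* If [N'] were the whole space, then [n = 1] and [M] would be zero, hence inside [Z]. *)
  apply/existsNP => NV; apply: nsub.
  suff M0 : rk M = 0%N.
    by move/rk_eq0: M0 => M0 x /(M0 sM) ->; apply: is_subspace0.
  have := rk_sub is_subspaceT sN (fun x _ => NV x).
  by rewrite rkT rN rM; lia.
have Mv : ~ M v by move=> /MN.
(* The dual test subspace: its sum with [Z] contains [N'] and [v], so has rank at least [n + 2], too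
   much for close subspaces. *)
have hW : halfspace (adjoin M v) by split; [auto|rewrite rk_adjoin // rM; lia].
have [sW rW] := hW.
have : close Z (adjoin M v) by apply: pW => //; left; apply: sub_adjoin.
have sZM : is_subspace (addS Z M) by auto.
have NZM : N' `<=` addS Z M.
  apply: rk_sub_eq; [by []|by []|exact: addS_sub|].
  have : (rk (Z `&` M) < n.-1)%N.
    rewrite ltnNge -rM; apply/negP => rMZ; apply: nsub.
    apply: subset_trans (@subIsetl _ Z M).
    by apply: rk_sub_eq rMZ; [auto|auto|apply: subIsetr].
  by have := rk_modular sZ sM; rewrite rN rM rZ; lia.
have AZW : adjoin N' v `<=` addS Z (adjoin M v).
  apply: adjoin_sub; [by auto| |by apply: sub_addSr; auto].
  apply: subset_trans NZM _; apply: addS_sub; [by auto|exact: sub_addSl|].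
  by apply: subset_trans (@sub_adjoin M v) _; apply: sub_addSr.
have := rk_sub (is_subspace_adjoin v sN) (is_subspace_addS sZ sW) AZW.
have := rk_modular sZ sW.
by rewrite (rk_adjoin sN NVv) rN rW rZ /close; lia.
Qed.

End Pencil.

(** Inside [S] the meet with [T] has corank at most one, so passing to it costs the meet of [Z] and
    [S] at most one dimension. *)
Lemma rk_meet_close S T Z : halfspace S -> halfspace T -> is_subspace Z -> close S T ->
  (rk (Z `&` S) <= (rk (Z `&` T)).+1)%N.
Proof.
move=> [sS rS] [sT rT] sZ; rewrite /close => cST.
have sZS := is_subspaceI sZ sS; have sST := is_subspaceI sS sT.
have := rk_modular sZS sST.
have : (rk (addS (Z `&` S) (S `&` T)) <= rk S)%N.
  by apply: rk_sub; [auto|auto|apply: addS_sub => // x []].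
have : (rk ((Z `&` S) `&` (S `&` T)) <= rk (Z `&` T))%N.
  by apply: rk_sub; [auto|auto|move=> x [[? ?] [? ?]]].
by rewrite rS; lia.
Qed.

(** [T] joins a hyperplane [H] of [S], chosen to contain the meet with [Z], to a vector [z] of [Z]
    outside [S]. *)
Lemma exists_closer S Z : halfspace S -> halfspace Z -> S <> Z ->
  exists T, [/\ halfspace T, close T S & (rk (Z `&` S) < rk (Z `&` T))%N].
Proof.
move=> hS hZ nSZ; have [[sS rS] [sZ rZ]] := (hS, hZ).
have [|z Zz Sz] := halfspace_nsub hZ hS; [by move=> ZS; apply: nSZ|].
have sZS := is_subspaceI sZ sS.
have ZSn := rk_meet_lt hS hZ nSZ; rewrite setIC in ZSn.
have [||H [sH ZSH HS rH]] := @rk_between (Z `&` S) S n.-1 sZS sS; first exact: subIsetr.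
  by rewrite rS; lia.
have Hz : ~ H z by move=> /HS.
exists (adjoin H z); split.
- by split; [auto|rewrite rk_adjoin // rH; lia].
- rewrite /close; have : (rk H <= rk (adjoin H z `&` S))%N.
    by apply: rk_sub; [auto|auto|move=> x Hx; split; [apply: sub_adjoin|apply: HS]].
  by rewrite rH; lia.
have ZSz : ~ (Z `&` S) z by case.
rewrite -(rk_adjoin sZS ZSz); apply: rk_sub; [by auto|by auto|].
apply: adjoin_sub; [by auto| |by split=> //; apply: mem_adjoin].
by move=> x ZSx; split; [case: ZSx|apply: sub_adjoin; apply: ZSH].
Qed.

End Subspaces.

(** * Grassmann spaces *)

Section Grassmannian.
Import VectorInternalTheory.
Variables (K : unitRingType) (U : vectType K).
Hypothesis K_div : GRing.field_axiom K.
Hypothesis U_gt0 : (0 < dim U)%N.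
Local Notation pt := (points (grassmann U)).
Implicit Types X Y Z W : pt.

(** Supplies [V_dim] for [U * U], whose half-dimensional subspaces are the points of the Grassmann
    space. *)
Lemma has_dim_prod : has_dim (setT : set (U * U)%type) (dim U + dim U).
Proof.
pose b (i : 'I_(dim U + dim U)) : U * U := match split i with
  | inl j => (r2v (delta_mx 0 j), 0) | inr j => (0, r2v (delta_mx 0 j)) end.
have bE (c : 'I_(dim U + dim U) -> K) : \sum_i c i *: b i =
    (r2v (\row_j c (lshift _ j)), r2v (\row_j c (rshift _ j))).
  have sumE (d : 'I_(dim U) -> K) : \sum_j d j *: r2v (delta_mx 0 j) = r2v (\row_j d j) :> U.
    rewrite [\row_j d j]row_sum_delta linear_sum; apply: eq_bigr => j _.
    by rewrite linearZ mxE.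
  have bl j : b (lshift _ j) = (r2v (delta_mx 0 j), 0) by rewrite /b (unsplitK (inl j)).
  have br j : b (rshift _ j) = (0, r2v (delta_mx 0 j)) by rewrite /b (unsplitK (inr j)).
  rewrite big_split_ord [LHS]surjective_pairing /= !raddf_sum /= -!sumE.
  under eq_bigr do rewrite bl. under [X in _ + X]eq_bigr do rewrite br.
  under [X in (_, X + _)]eq_bigr do rewrite bl. under [X in (_, _ + X)]eq_bigr do rewrite br.
  rewrite [X in (_ + X, _)]big1 ?addr0 => [|j _]; last exact: scaler0.
  by rewrite [X in (_, X + _)]big1 ?add0r // => j _; apply: scaler0.
exists b => [c|].
  rewrite bE => -[/(congr1 v2r) + /(congr1 v2r)].
  rewrite !r2vK !linear0 => /rowP c0 /rowP c1 i.
  by case: (split_ordP i) => j ->; [have := c0 j|have := c1 j]; rewrite !mxE.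
apply/seteqP; split=> // -[x y] _.
exists (fun i => match split i with inl j => v2r x 0 j | inr j => v2r y 0 j end) => //.
rewrite bE -[x in RHS]v2rK -[y in RHS]v2rK; congr (r2v _, r2v _).
  by apply/rowP=> j; rewrite mxE (unsplitK (inl j)).
by apply/rowP=> j; rewrite mxE (unsplitK (inr j)).
Qed.

Definition gclose X Y := close (dim U) (sval X) (sval Y).

Definition skew X Y := sval X `&` sval Y `<=` [set 0].

Lemma halfspace_grass X : halfspace (dim U) (sval X).
Proof.
by case: X => X hX; split; [apply: has_dim_subspace hX | apply: has_dim_rkE hX].
Qed.

Lemma grass_halfspace (S : set (U * U)%type) : halfspace (dim U) S -> exists X, sval X = S.
Proof.
move=> [sS rS]; have hS : has_dim S (dim U).
  by rewrite -rS; apply: (has_dim_rk K_div has_dim_prod).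
by exists (exist _ S hS).
Qed.

Lemma sval_neq X Y : X <> Y -> sval X <> sval Y.
Proof. by move=> XY /sval_injective. Qed.

Lemma exists_skew X : exists Z, skew Z X.
Proof.
have [|S [/grass_halfspace[Z <-] _ ZX]] := exists_disjoint_halfspace K_div has_dim_prod
  U_gt0 erefl (halfspace_grass X) (is_subspace_set0 _); last by exists Z.
by move=> x [].
Qed.

Lemma exists_separating X Y : X <> Y -> exists2 Z, skew Z X & ~ skew Z Y.
Proof.
move/sval_neq => XY; have [S [/grass_halfspace[Z <-] ZX ZY]] :=
  exists_separating_halfspace K_div has_dim_prod U_gt0 erefl
    (halfspace_grass X) (halfspace_grass Y) XY.
by exists Z.
Qed.

Lemma cover_gclose X Y Z : Z <> X -> Z <> Y -> (forall W, skew W Z -> skew W X \/ skew W Y) ->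
  X <> Y /\ gclose X Y.
Proof.
move=> /sval_neq ZX /sval_neq ZY cov.
have [|XY cXY] := cover_close K_div has_dim_prod U_gt0 erefl
  (halfspace_grass X) (halfspace_grass Y) (halfspace_grass Z) ZX ZY.
  by move=> S /grass_halfspace[W <-]; apply: cov.
by split=> // E; apply: XY; rewrite E.
Qed.

Lemma gclose_cover X Y : X <> Y -> gclose X Y ->
  exists Z, [/\ Z <> X, Z <> Y & forall W, skew W Z -> skew W X \/ skew W Y].
Proof.
move=> /sval_neq XY cXY.
have [S [/grass_halfspace[Z <-] ZX ZY cov]] := close_cover K_div has_dim_prod U_gt0 erefl
  (halfspace_grass X) (halfspace_grass Y) XY cXY.
exists Z; split=> [E|E|W]; [by apply: ZX; rewrite E|by apply: ZY; rewrite E|].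
by apply: cov; apply: halfspace_grass.
Qed.

(** The line is the pencil between the meet and the sum of [X] and [Y], whose ranks come from
    [close_rk]. *)
Lemma gclose_line X Y : X <> Y -> gclose X Y ->
  exists L, [/\ lines (g := grassmann U) L, L X & L Y].
Proof.
move=> /sval_neq XY cXY; have [sX _] := halfspace_grass X; have [sY _] := halfspace_grass Y.
have [rM rN] := close_rk K_div has_dim_prod U_gt0 erefl
  (halfspace_grass X) (halfspace_grass Y) XY cXY.
exists [set Z : pt | sval X `&` sval Y `<=` sval Z /\ sval Z `<=` addS (sval X) (sval Y)].
split; last 2 first.
- by split; [exact: subIsetl|exact: sub_addSl].
- by split; [exact: subIsetr|exact: sub_addSr].
exists (sval X `&` sval Y), (addS (sval X) (sval Y)); split=> //.
- by rewrite -rM; apply: (has_dim_rk K_div has_dim_prod); apply: is_subspaceI.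
- by rewrite -rN; apply: (has_dim_rk K_div has_dim_prod); apply: is_subspace_addS.
- by move=> x [Xx _]; apply: sub_addSl.
Qed.

Lemma line_gclose (L : set pt) X Y : lines (g := grassmann U) L -> L X -> L Y -> gclose X Y.
Proof.
move=> [M [N [hM hN MN ->]]] [MX _] [MY _].
apply: (between_close K_div has_dim_prod U_gt0 erefl (halfspace_grass X) (halfspace_grass Y)
  _ _ MX MY).
  exact: has_dim_subspace hM.
exact: has_dim_rkE.
Qed.

Lemma line_hull (L : set pt) X Y Z : lines (g := grassmann U) L -> L X -> L Y -> X <> Y ->
  L Z <-> forall W, gclose W X -> gclose W Y -> gclose Z W.
Proof.
move=> [M [N [hM hN MN ->]]] LX LY /sval_neq XY.
rewrite -[_ Z]/(M `<=` sval Z /\ sval Z `<=` N).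
have -> := pencilP K_div has_dim_prod U_gt0 erefl (has_dim_subspace hM) (has_dim_subspace hN)
  (has_dim_rkE K_div hM) (has_dim_rkE K_div hN) (halfspace_grass X) (halfspace_grass Y)
  (halfspace_grass Z) XY MN LX LY.
split=> [H W|H _ /grass_halfspace[W <-]]; last exact: H.
by apply: H; apply: halfspace_grass.
Qed.

(** [X] is [M] with a vector of [N] adjoined, and [Y] is [M] with a vector of [N] outside [X]. *)
Lemma line_nontrivial (L : set pt) : lines (g := grassmann U) L ->
  exists X Y, [/\ L X, L Y & X <> Y].
Proof.
move=> [M [N [hM hN MN ->]]].
have [sM sN] := (has_dim_subspace hM, has_dim_subspace hN).
have [rM rN] := (has_dim_rkE K_div hM, has_dim_rkE K_div hN).
have next (S : set (U * U)%type) : is_subspace S -> (rk S < rk N)%N -> exists2 v, N v & ~ S v.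
  move=> sS; apply: contraPP => /forall2NP SN; rewrite ltnNge => /negP; apply.
  apply: (rk_sub K_div has_dim_prod) => // v Nv.
  by case: (SN v) => // /contrapT.
have pack v : N v -> ~ M v -> exists Z, sval Z = adjoin M v.
  move=> Nv Mv; apply: grass_halfspace; split; first exact: is_subspace_adjoin.
  by rewrite (rk_adjoin K_div has_dim_prod) // rM prednK.
have [|v Nv Mv] := next M sM; first by rewrite rM rN; lia.
have [X XE] := pack v Nv Mv; have [sX rX] := halfspace_grass X.
have [|w Nw Xw] := next (sval X) sX; first by rewrite rX rN.
have Mw : ~ M w by move=> Mw; apply: Xw; rewrite XE; apply: sub_adjoin.
have [Y YE] := pack w Nw Mw.
exists X, Y; split; rewrite /mkset ?XE ?YE.
- by split; [exact: sub_adjoin|exact: adjoin_sub].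
- by split; [exact: sub_adjoin|exact: adjoin_sub].
- by move=> XY; apply: Xw; rewrite XY YE; apply: mem_adjoin.
Qed.

(** * Distance in a single Grassmann space *)

Definition meet_rk X Y := rk (sval X `&` sval Y).

(** The distance in the collinearity graph; by [meet_rk_le] the subtraction never truncates. *)
Definition codim X Y := (dim U - meet_rk X Y)%N.

Lemma meet_rk_le X Y : (meet_rk X Y <= dim U)%N.
Proof.
have [[sX rX] [sY _]] := (halfspace_grass X, halfspace_grass Y).
have := rk_sub K_div has_dim_prod (is_subspaceI sX sY) sX (@subIsetl _ _ _).
by rewrite rX.
Qed.

Lemma codim_eq0 X Y : codim X Y = 0%N -> X = Y.
Proof.
move=> XY; apply: contrapT => /sval_neq neXY.
have : (meet_rk X Y < dim U)%N.
  exact: rk_meet_lt K_div _ has_dim_prod _ _ _ (halfspace_grass X) (halfspace_grass Y) neXY.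
by move: XY; rewrite /codim; lia.
Qed.

Lemma codim_refl X : codim X X = 0%N.
Proof. by rewrite /codim /meet_rk setIid (proj2 (halfspace_grass X)) subnn. Qed.

Lemma codim_skew X Y : skew X Y <-> codim X Y = dim U.
Proof.
have [[sX rX] [sY _]] := (halfspace_grass X, halfspace_grass Y).
have : meet_rk X Y = 0%N <-> skew X Y.
  by apply: (rk_eq0 K_div has_dim_prod); apply: is_subspaceI.
move=> <-; rewrite /codim; have := meet_rk_le X Y; lia.
Qed.

Lemma codim_gclose X Y Z : gclose Y Z -> (codim X Z <= (codim X Y).+1)%N.
Proof.
move=> cYZ; have : (meet_rk X Y <= (meet_rk X Z).+1)%N.
  exact: (rk_meet_close K_div has_dim_prod U_gt0 erefl (halfspace_grass Y) (halfspace_grass Z)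
    (proj1 (halfspace_grass X)) cYZ).
by rewrite /codim; lia.
Qed.

Lemma codim_step X Y : X <> Y -> exists2 Z, gclose Z Y & (codim X Z < codim X Y)%N.
Proof.
move=> XY; have YX : Y <> X by move=> YX; apply: XY.
have [S [/grass_halfspace[Z <-] ZY rZ]] := exists_closer K_div has_dim_prod U_gt0 erefl
  (halfspace_grass Y) (halfspace_grass X) (sval_neq YX).
exists Z => //; have {rZ} : (meet_rk X Y < meet_rk X Z)%N by [].
by have := meet_rk_le X Z; rewrite /codim; lia.
Qed.

End Grassmannian.

(** * Segre products *)

(** Walks of exactly [k] steps; for a reflexive relation such as [near] this means distance at most
    [k]. *)
Fixpoint reach (T : Type) (e : T -> T -> Prop) (k : nat) (x y : T) : Prop :=
  if k is k'.+1 then exists2 z, reach e k' x z & e z y else x = y.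

(** Built from [e] alone, hence respected by every bijection that preserves [e] both ways; for
    [near] it yields the lines. *)
Definition hull (T : Type) (e : T -> T -> Prop) (x y : T) : set T :=
  [set z | forall w, e w x -> e w y -> e z w].

Section Product.
Variables (I : finType) (K : I -> unitRingType) (U : forall i, vectType (K i)).
Hypothesis i0 : I.
Hypothesis K_div : forall i, GRing.field_axiom (K i).
Hypothesis U_gt0 : forall i, (0 < dim (U i))%N.
Local Notation pt := (points (product_space U)).
Implicit Types P Q R Z W : pt.

(** Collinear or equal, as [gclose] admits equal components. *)
Definition near P Q := exists j, (forall i, i <> j -> P i = Q i) /\ gclose (P j) (Q j).

Definition opposite P Q := forall i, skew (P i) (Q i).

Lemma near_refl P : near P P.
Proof. by exists i0; split=> //; apply: close_refl; apply: halfspace_grass. Qed.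

Lemma near_sym P Q : near P Q -> near Q P.
Proof. by move=> [j [PQ cPQ]]; exists j; split=> [i /PQ //|]; rewrite /gclose closeC. Qed.

Lemma pt_eqP P Q : (forall i, P i = Q i) -> P = Q.
Proof. exact: functional_extensionality_dep. Qed.

Lemma pt_neqP P Q : P <> Q -> exists i, P i <> Q i.
Proof. by move=> PQ; apply/existsNP => E; apply: PQ; apply: pt_eqP. Qed.

Definition upd P j (X : points (grassmann (U j))) : pt := dfwith P X.

Lemma upd_in P j (X : points (grassmann (U j))) : upd P X j = X.
Proof. exact: dfwith_in. Qed.

Lemma upd_out P j (X : points (grassmann (U j))) i : i <> j -> upd P X i = P i.
Proof. by move=> ij; apply: dfwith_out; apply/eqP => ji; apply: ij. Qed.

Lemma exists_opposite P : exists Z, opposite Z P.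
Proof.
have ex i : {X | skew X (P i)} by apply: cid; apply: exists_skew.
by exists (fun i => sval (ex i)) => i; apply: svalP (ex i).
Qed.

Lemma opposite_upd P Z j (X : points (grassmann (U j))) :
  opposite Z P -> skew X (P j) -> opposite (upd Z X) P.
Proof.
move=> ZP XP i; have [->|ij] := pselect (i = j); first by rewrite upd_in.
by rewrite upd_out.
Qed.

Lemma opposite_separates P Q : P <> Q -> exists2 Z, opposite Z P & ~ opposite Z Q.
Proof.
move=> /pt_neqP[j /(exists_separating (@K_div j) (U_gt0 j))[X XP XQ]].
have [Z ZP] := exists_opposite P.
exists (upd Z X); first exact: opposite_upd.
by move=> /(_ j); rewrite upd_in.
Qed.

(** [R] must differ from [P] and from [Q] in one and the same component, where [cover_gclose]
    applies. *)
Lemma cover_near P Q R : R <> P -> R <> Q ->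
  (forall Z, opposite Z R -> opposite Z P \/ opposite Z Q) -> P <> Q /\ near P Q.
Proof.
move=> RP RQ cov; have [E ER] := exists_opposite R.
have key i j : i <> j -> R i <> P i -> R j = Q j.
  move=> ij /(exists_separating (@K_div i) (U_gt0 i))[X XR XP].
  apply: contrapT => /(exists_separating (@K_div j) (U_gt0 j))[Y YR YQ].
  (* If [R] differed from [P] at [i] and from [Q] at [j], an opposite of [R] altered at both places
     would be opposite to neither [P] nor [Q]. *)
  have := cov (upd (upd E X) Y); case=> [|/(_ i)|/(_ j)].
  - by do 2!apply: opposite_upd => //.
  - by rewrite upd_out // upd_in.
  - by rewrite upd_in.
have [i RPi] := pt_neqP RP; have [j RQj] := pt_neqP RQ.
have ij : i = j by apply: contrapT => ij; apply: RQj; apply: key ij RPi.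
subst j.
have RQ' j : j <> i -> R j = Q j by move=> ji; apply: key RPi => ij; apply: ji.
have RP' j : j <> i -> R j = P j.
  move=> ji; apply: contrapT => /(key _ _ ji) ?; exact: RQj.
have [|PQ cPQ] := cover_gclose (@K_div i) (U_gt0 i) RPi RQj.
  move=> X XR; have := cov (upd E X); case=> [|/(_ i)|/(_ i)].
  - exact: opposite_upd.
  - by rewrite upd_in; left.
  - by rewrite upd_in; right.
split=> [E'|]; first by apply: PQ; rewrite E'.
by exists i; split=> // j ji; rewrite -RP' ?RQ'.
Qed.

(** [R] is [P] with component [j] replaced by a third member of the pencil; outside [j], points
    opposite to [R] are skew to [P] and [Q] anyway. *)
Lemma near_cover P Q : P <> Q -> near P Q ->
  exists R, [/\ R <> P, R <> Q & forall Z, opposite Z R -> opposite Z P \/ opposite Z Q].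
Proof.
move=> PQ [j [PQj cPQ]].
have neq : P j <> Q j.
  move=> E; apply: PQ; apply: pt_eqP => i.
  by have [->//|/PQj] := pselect (i = j).
have [X [XP XQ cov]] := gclose_cover (@K_div j) (U_gt0 j) neq cPQ.
exists (upd P X); split.
- by move=> E; apply: XP; rewrite -E upd_in.
- by move=> E; apply: XQ; rewrite -E upd_in.
move=> Z ZX; have ZP i : i <> j -> skew (Z i) (P i) by move=> ij; rewrite -(upd_out P X ij).
have [|ZPj|ZQj] := cov (Z j); first by have := ZX j; rewrite upd_in.
- by left=> i; have [->//|/ZP] := pselect (i = j).
- right=> i; have [->//|ij] := pselect (i = j).
  by rewrite -PQj //; apply: ZP.
Qed.

Lemma line_near (L : set pt) P Q : lines (g := product_space U) L -> L P -> L Q -> near P Q.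
Proof.
move=> [j [l [A [hl ->]]]] [lP AP] [lQ AQ]; exists j; split=> [i ij|].
  by rewrite AP ?AQ.
exact: (line_gclose (@K_div j) (U_gt0 j) hl lP lQ).
Qed.

Lemma near_line P Q : P <> Q -> near P Q ->
  exists L, [/\ lines (g := product_space U) L, L P & L Q].
Proof.
move=> PQ [j [PQj cPQ]].
have neq : P j <> Q j.
  move=> E; apply: PQ; apply: pt_eqP => i.
  by have [->//|/PQj] := pselect (i = j).
have [l [hl lP lQ]] := gclose_line (@K_div j) (U_gt0 j) neq cPQ.
exists [set x : pt | l (x j) /\ forall i, i <> j -> x i = P i]; split=> //.
  by exists j, l, P.
by split=> // i ij; rewrite PQj.
Qed.

Lemma product_line_nontrivial (L : set pt) : lines (g := product_space U) L ->
  exists P Q, [/\ L P, L Q & P <> Q].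
Proof.
move=> [j [l [A [hl ->]]]].
have [X [Y [lX lY XY]]] := line_nontrivial (@K_div j) (U_gt0 j) hl.
exists (upd A X), (upd A Y); split.
- by split=> [|i ij]; rewrite ?upd_in ?upd_out.
- by split=> [|i ij]; rewrite ?upd_in ?upd_out.
- by move=> E; apply: XY; rewrite -(upd_in A X) E upd_in.
Qed.

(** If [W] left [P] in a component other than [j], it would differ from [Q] at [j], hence only
    there, and so equal [P]. *)
Lemma near_both P Q W j : (forall i, i <> j -> P i = Q i) -> P j <> Q j ->
  near W P -> near W Q -> (forall i, i <> j -> W i = P i) /\ gclose (W j) (P j).
Proof.
move=> PQ PQj [k [WP cP]] [l [WQ cQ]].
have [kj|kj] := pselect (k = j); first by subst k.
have jl : l = j.
  apply: contrapT => lj; apply: PQj; rewrite -WP; last by move=> jk; apply: kj.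
  by apply: WQ => jl; apply: lj.
subst l.
have E : W = P.
  by apply: pt_eqP => i; have [->|/WP//] := pselect (i = k); rewrite WQ ?PQ.
by rewrite E; split=> //; apply: close_refl; apply: halfspace_grass.
Qed.

(** By [near_both], the common neighbours of [P] and [Q] vary in component [j] only, which reduces
    the claim to [line_hull]. *)
Lemma product_line_hull (L : set pt) P Q : lines (g := product_space U) L -> L P -> L Q -> P <> Q ->
  L = hull near P Q.
Proof.
move=> [j [l [A [hl ->]]]] [lP AP] [lQ AQ] nPQ.
have PQ i : i <> j -> P i = Q i by move=> ij; rewrite AP ?AQ.
have PQj : P j <> Q j.
  by move=> E; apply: nPQ; apply: pt_eqP => i; have [->//|/PQ] := pselect (i = j).
have hullj Z := line_hull (@K_div j) (U_gt0 j) (Z j) hl lP lQ PQj.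
have both W : near W P -> near W Q ->
    [/\ forall i, i <> j -> W i = P i, gclose (W j) (P j) & gclose (W j) (Q j)].
  move=> WP WQ; have [WPi WPj] := near_both PQ PQj WP WQ.
  have [||_ WQj] := @near_both Q P W j _ _ WQ WP.
  - by move=> i /PQ.
  - by move=> E; apply: PQj.
  - by split.
apply/seteqP; split=> Z.
  move=> [lZ AZ] W WP WQ; have [WPi WPj WQj] := both W WP WQ.
  exists j; split=> [i ij|]; first by rewrite AZ // WPi // AP.
  by apply: (proj1 (hullj Z) lZ).
(* [P] and [Q] are themselves test points, so [Z] is near both and agrees with [P] outside [j]. *)
move=> ZPQ; have nPQ' : near P Q.
  exists j; split=> //; exact: (line_gclose (@K_div j) (U_gt0 j) hl lP lQ).
have ZP := ZPQ P (near_refl P) nPQ'.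
have ZQ := ZPQ Q (near_sym nPQ') (near_refl Q).
have [ZPi _ _] := both Z ZP ZQ.
split=> [|i ij]; last by rewrite ZPi // AP.
apply/hullj => X XP XQ.
have nXP : near (upd P X) P by exists j; split=> [i ij|]; rewrite ?upd_in ?upd_out.
have nXQ : near (upd P X) Q by exists j; split=> [i ij|]; rewrite ?upd_in ?upd_out ?PQ.
have [k [ZXk cZX]] := ZPQ _ nXP nXQ.
(* If the component in which [Z] and the test point may differ is not [j], then [Z j = X], and
   reflexivity suffices. *)
have [kj|kj] := pselect (k = j); first by subst k; rewrite upd_in in cZX.
have := ZXk j; rewrite upd_in => -> => [|jk]; last by apply: kj.
by apply: close_refl; apply: halfspace_grass.
Qed.

(** * Distance in the collinearity graph of the product *)

Definition codims P Q := (\sum_i codim (P i) (Q i))%N.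

Definition dims := (\sum_i dim (U i))%N.

Lemma codims_le P Q : (codims P Q <= dims)%N.
Proof. by apply: leq_sum => i _; apply: leq_subr. Qed.

Lemma codims_near P Q R : near Q R -> (codims P R <= (codims P Q).+1)%N.
Proof.
move=> [j [QR cQR]]; rewrite /codims (bigD1 j) //= [X in (_ <= X.+1)%N](bigD1 j) //=.
have := codim_gclose (@K_div j) (U_gt0 j) (P j) cQR.
rewrite (eq_bigr (fun i => codim (P i) (Q i))) => [|i /eqP/QR -> //]; lia.
Qed.

Lemma codims_step P Q : P <> Q -> exists2 R, near R Q & (codims P R < codims P Q)%N.
Proof.
move=> /pt_neqP[j /(codim_step (@K_div j) (U_gt0 j))[X XQ PX]].
exists (upd Q X).
  by exists j; split=> [i ij|]; rewrite ?upd_in ?upd_out.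
rewrite /codims (bigD1 j) //= [X in (_ < X)%N](bigD1 j) //= upd_in.
rewrite (eq_bigr (fun i => codim (P i) (Q i))) => [|i /eqP ij]; last by rewrite upd_out.
by rewrite ltn_add2r.
Qed.

(** A step raises [codims] by at most one ([codims_near]), and between distinct points some step
    lowers it ([codims_step]). *)
Lemma reachP k P Q : reach near k P Q <-> (codims P Q <= k)%N.
Proof.
elim: k Q => [|k IHk] Q /=.
  split=> [<-|]; first by rewrite /codims big1 // => i _; apply: codim_refl.
  rewrite leqn0 sum_nat_eq0 => /forallP PQ; apply: pt_eqP => i.
  by apply: (codim_eq0 (@K_div i) (U_gt0 i)); apply/eqP; apply: (implyP (PQ i)).
split=> [[R /IHk PR /(codims_near P) PQ]|PQ]; first by lia.
(* Walks have exact length, so equal points need a stationary last step. *)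
have [E|/codims_step[R RQ PR]] := pselect (P = Q).
  exists Q; last exact: near_refl.
  by apply/IHk; rewrite E /codims big1 // => i _; apply: codim_refl.
by exists R => //; apply/IHk; lia.
Qed.

(** Each summand of [codims] is bounded by that of [dims], so the sums agree only if all summands
    do. *)
Lemma opposite_codims P Q : opposite P Q <-> codims P Q = dims.
Proof.
split=> [PQ|PQ i]; first by apply: eq_bigr => i _; apply/(codim_skew (@K_div i) (U_gt0 i)).
apply/(codim_skew (@K_div i) (U_gt0 i)).
have : (codims P Q = dims)%N by [].
rewrite /codims /dims (bigD1 i) //= [RHS](bigD1 i) //=.
have : (\sum_(j | j != i) codim (P j) (Q j) <= \sum_(j | j != i) dim (U j))%N.
  by apply: leq_sum => j _; apply: leq_subr.
by have := leq_subr (meet_rk (P i) (Q i)) (dim (U i)); rewrite -/(codim (P i) (Q i)); lia.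
Qed.

(** Opposite points are those whose distance is the diameter. Only [near] occurs on the right, so
    collineations carry the property over. *)
Lemma opposite_reach P Q :
  opposite P Q <-> forall k, reach near k P Q -> forall A B, reach near k A B.
Proof.
rewrite opposite_codims; split=> [PQ k /reachP + A B|PQ].
  by rewrite PQ => hk; apply/reachP; apply: leq_trans (codims_le A B) hk.
have [Z /opposite_codims ZP] := exists_opposite P.
have hPQ : reach near (codims P Q) P Q by apply/reachP.
have /reachP := PQ _ hPQ Z P; rewrite ZP => ZPQ.
by apply/eqP; rewrite eqn_leq codims_le.
Qed.

End Product.

(** * Projective lines *)

(** Lets the second row of an invertible matrix be treated as a point through [row_point]. *)
Lemma GL2_xrow (R : pzRingType) (M : 'M[R]_2) : GL2 M -> GL2 (xrow 0 1 M).
Proof.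
have TT : tperm_mx 0 1 *m tperm_mx 0 1 = 1%:M :> 'M[R]_2.
  by rewrite /tperm_mx -perm_mxM tperm2 perm_mx1.
move=> [N [MN NM]]; exists (N *m tperm_mx 0 1); rewrite xrowE; split.
  by rewrite mulmxA -[_ *m M *m N]mulmxA MN mulmx1 TT.
by rewrite mulmxA -[_ *m _ *m tperm_mx 0 1]mulmxA TT mulmx1 NM.
Qed.

Lemma row_xrow (R : pzRingType) (M : 'M[R]_2) : row 0 (xrow 0 1 M) = row 1 M.
Proof. by apply/rowP=> k; rewrite !mxE tpermL. Qed.

(** Invertible matrices of the components, with their inverses, are assembled entrywise over the
    product ring. *)
Lemma distant_component (I : Type) (R : I -> pzRingType) (p q : projline (prodring R)) :
  distant p q <-> forall i, distant (component p i) (component q i).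
Proof.
split=> [[M GM [pM qM]] i|pq].
  exists (map_mx (@proj I R i) M); first exact: GL2_proj.
  by rewrite /= pM qM !component_setE /row_proj !map_row.
have ex i : {MN : 'M[R i]_2 * 'M[R i]_2 | [/\ MN.1 *m MN.2 = 1%:M, MN.2 *m MN.1 = 1%:M,
    sval (component p i) = cyclic_submod (row 0 MN.1) &
    sval (component q i) = cyclic_submod (row 1 MN.1)]}.
  by apply: cid; have [M [N [MN NM]] [pM qM]] := pq i; exists (M, N).
pose M : 'M[prodring R]_2 := \matrix_(k, l) (fun i => (sval (ex i)).1 k l).
pose N : 'M[prodring R]_2 := \matrix_(k, l) (fun i => (sval (ex i)).2 k l).
have Mi i : map_mx (@proj I R i) M = (sval (ex i)).1 by apply/matrixP=> k l; rewrite !mxE.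
have Ni i : map_mx (@proj I R i) N = (sval (ex i)).2 by apply/matrixP=> k l; rewrite !mxE.
have mxext (A B : 'M[prodring R]_2) :
    (forall i, map_mx (@proj I R i) A = map_mx (@proj I R i) B) -> A = B.
  move=> AB; apply/matrixP=> k l; apply: functional_extensionality_dep => i.
  by have /matrixP/(_ k l) := AB i; rewrite !mxE.
have GM : GL2 M.
  exists N; split; apply: mxext => i; rewrite map_mxM map_mx1 Mi Ni;
    by case: (svalP (ex i)).
exists M => //; rewrite -row_xrow.
split; [have -> : p = row_point GM | have -> : q = row_point (GL2_xrow GM)] => //;
  apply: component_inj => i; apply: sval_injective; rewrite /= component_setE ?row_xrow.
  by rewrite /row_proj map_row Mi; case: (svalP (ex i)).
by rewrite /row_proj map_row Mi; case: (svalP (ex i)).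
Qed.

(** * Distant points over an endomorphism ring *)

Section EndoDistant.
Import VectorInternalTheory.
Variables (K : unitRingType) (U : vectType K).
Local Notation n := (dim U).

Let mk (A : 'M[K]_n) : endo U := Hom A.

Let mkE A u : endo_fun (mk A) u = r2v (v2r u *m A).
Proof. by rewrite /endo_fun unlock. Qed.

Let mk_f2mx (f : endo U) : mk (f2mx f) = f. Proof. by case: f. Qed.

Let mk_mulD A B C D : mk A * mk B + mk C * mk D = mk (A *m B + C *m D).
Proof.
by apply: endoP => u; rewrite endo_addE !endo_mulE !mkE !r2vK -!mulmxA mulmxDr linearD.
Qed.

Let mk1 : mk 1%:M = 1.
Proof. by apply: endoP => u; rewrite mkE endo_1E mulmx1 v2rK. Qed.

Let mk0 : mk 0 = 0.
Proof. by apply: endoP => u; rewrite mkE mulmx0 linear0 /endo_fun zero_lfunE. Qed.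

(** Identifies square matrices of size [2 dim U], cut into blocks, with 2 by 2 matrices over
    [endo U]; [Hom] respects the left-to-right product. *)
Definition endo_block (A B C D : 'M[K]_n) : 'M[endo U]_2 :=
  \matrix_(k, l) mk (if k == 0 then if l == 0 then A else B else if l == 0 then C else D).

Lemma endo_block_mul A B C D A' B' C' D' : endo_block A B C D *m endo_block A' B' C' D' =
  endo_block (A *m A' + B *m C') (A *m B' + B *m D') (C *m A' + D *m C') (C *m B' + D *m D').
Proof.
apply/matrixP=> k l; rewrite !mxE !big_ord_recl big_ord0 addr0 !mxE /= mk_mulD.
by case: (k == 0); case: (l == 0).
Qed.

Lemma endo_block1 : endo_block 1%:M 0 0 1%:M = 1%:M.
Proof.
by apply/matrixP => -[[|[|k]] ?] [[|[|l]] ?]; rewrite //= !mxE //= ?mk1 ?mk0.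
Qed.

Lemma GL2_endo_block A B C D (P : 'M[K]_(n + n)) :
  block_mx A B C D *m P = 1%:M -> P *m block_mx A B C D = 1%:M -> GL2 (endo_block A B C D).
Proof.
rewrite -[P]submxK !mulmx_block scalar_mx_block.
move=> /eq_block_mx[e1 e2 e3 e4] /eq_block_mx[f1 f2 f3 f4].
exists (endo_block (ulsubmx P) (ursubmx P) (dlsubmx P) (drsubmx P)).
by rewrite !endo_block_mul e1 e2 e3 e4 f1 f2 f3 f4 endo_block1.
Qed.

(** Two points span an invertible matrix exactly when their graphs meet in zero: disjoint graphs
    give a block matrix with trivial left kernel, invertible by [free_completion]. *)
Lemma distant_skew (K_div : GRing.field_axiom K) (p q : projline (endo U)) :
  distant p q <-> skew (grass_point p) (grass_point q).
Proof.
split.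
  move=> [M [N [MN _]] [pM qM]] x.
  rewrite /= pM qM !grass_setE => -[[u _ <-] [w _]].
  rewrite !mxE => -[E0 E1].
  have lift01 : lift ord0 ord0 = 1 :> 'I_2 by apply: val_inj.
  have := MN => /matrixP MNE.
  have := MNE 0 0; rewrite !mxE !big_ord_recl big_ord0 addr0 lift01 eqxx mulr1n => e0.
  have := MNE 1 0; rewrite !mxE !big_ord_recl big_ord0 addr0 lift01 mulr0n => e1.
  (* The first column of [N] sends the common vector to [u] by the first row of [M] and to zero by
     the second. *)
  have u0 : u = 0.
    rewrite -[LHS]endo_1E -e0 endo_addE !endo_mulE -E0 -E1 -!endo_mulE -endo_addE e1.
    by rewrite /endo_fun zero_lfunE.
  by rewrite u0 /endo_fun !linear0.
have [v [x [y [pv vxy]]]] := projlineP p; have [w [z [t [qw wzt]]]] := projlineP q.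
rewrite /skew /= pv qw !grass_setE => vw.
pose A := f2mx (v 0 0); pose B := f2mx (v 0 1); pose C := f2mx (w 0 0); pose D := f2mx (w 0 1).
have fE (f : endo U) (c : 'rV_n) : c *m f2mx f = v2r (endo_fun f (r2v c)).
  by rewrite -[f in endo_fun f]mk_f2mx mkE !r2vK.
have recover (s : 'rV[endo U]_2) a b u : s 0 0 * a + s 0 1 * b = 1 ->
    endo_fun (s 0 0) u = 0 -> endo_fun (s 0 1) u = 0 -> u = 0.
  move=> sab s0 s1; rewrite -[LHS]endo_1E -sab endo_addE !endo_mulE s0 s1.
  by rewrite /endo_fun !linear0 addr0.
(* A row [(a, b)] of the left kernel gives a vector common to both graphs: the image of [a] under
   [v] and of [- b] under [w]. *)
have free (c : 'rV_(n + n)) : c *m block_mx A B C D = 0 -> c = 0.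
  rewrite -[c]hsubmxK mul_row_block -row_mx0 => /eq_row_mx[].
  rewrite !fE -!linearD -(linear0 v2r) => /(can_inj v2rK) e0 /(can_inj v2rK) e1.
  move: (lsubmx c) (rsubmx c) e0 e1 => a b /eqP; rewrite addr_eq0 => /eqP e0.
  move=> /eqP; rewrite addr_eq0 => /eqP e1.
  have /vw [a0 a1] : (endo_graph v `&` endo_graph w)
      (endo_fun (v 0 0) (r2v a), endo_fun (v 0 1) (r2v a)).
    split; first by exists (r2v a).
    by exists (r2v (- b)) => //; rewrite e0 e1 /endo_fun !linearN.
  have b0 : endo_fun (w 0 0) (r2v b) = 0 by rewrite -[LHS]opprK -e0 a0 oppr0.
  have b1 : endo_fun (w 0 1) (r2v b) = 0 by rewrite -[LHS]opprK -e1 a1 oppr0.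
  have ra := recover _ _ _ _ vxy a0 a1; have rb := recover _ _ _ _ wzt b0 b1.
  by rewrite -[a]r2vK -[b]r2vK ra rb !linear0 row_mx0.
have [[P [Q [PQ QP BP]]] _] := free_completion K_div free.
rewrite pid_mx_1 in BP.
have BQ : block_mx A B C D = Q by rewrite -[LHS]mulmx1 -PQ mulmxA BP mul1mx.
exists (endo_block A B C D); first by apply: GL2_endo_block BP _; rewrite BQ.
have ord2 (k : 'I_2) : k = 0 \/ k = 1.
  by case: k => [[|[|k]]] // k2; [left|right]; apply: val_inj.
split; [rewrite pv|rewrite qw]; congr cyclic_submod; apply/rowP=> k; rewrite !mxE /=;
  by case: (ord2 k) => ->; rewrite /= mk_f2mx.
Qed.

End EndoDistant.

(** * The relations of the projective line read in the product space *)

Section Transfer.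
Variables (I : finType) (K : I -> unitRingType) (U : forall i, vectType (K i)).
Hypothesis i0 : I.
Hypothesis K_div : forall i, GRing.field_axiom (K i).
Hypothesis U_gt0 : forall i, (0 < dim (U i))%N.
Implicit Types p q r : projline (prodring (fun i => endo (U i))).

Lemma distant_opposite p q : distant p q <-> opposite (Psi p) (Psi q).
Proof.
by rewrite distant_component; split=> pq i; apply/(distant_skew (@K_div i)); apply: pq.
Qed.

(** Distinct points are separated by a point opposite to only one of them, so the parallelism
    clauses of adjacency become inequalities. *)
Lemma parallel_eq p q : parallel p q <-> p = q.
Proof.
split=> [pq|-> //]; apply: (@Psi_inj _ K); apply: contrapT.
move=> /(opposite_separates K_div U_gt0)[Z]; rewrite -(Psi_invK K_div Z).
by move=> /distant_opposite/pq/distant_opposite.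
Qed.

Lemma adjacent_near p q : adjacent p q <-> Psi p <> Psi q /\ near (Psi p) (Psi q).
Proof.
split=> [[r [rp rq cov]]|[pq /(near_cover K_div U_gt0 pq)[R [Rp Rq cov]]]].
  apply: (cover_near K_div U_gt0 (R := Psi r)).
  - by move=> /(@Psi_inj _ K)/parallel_eq.
  - by move=> /(@Psi_inj _ K)/parallel_eq.
  move=> Z; rewrite -(Psi_invK K_div Z) => /distant_opposite/cov.
  by case=> [/distant_opposite|/distant_opposite]; [left|right].
exists (Psi_inv K_div R); split=> [/parallel_eq E|/parallel_eq E|z].
- by apply: Rp; rewrite -E Psi_invK.
- by apply: Rq; rewrite -E Psi_invK.
rewrite /distants /= => /distant_opposite; rewrite Psi_invK => /cov.
by case=> [/distant_opposite|/distant_opposite]; [left|right].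
Qed.

Lemma near_adjacent p q : near (Psi p) (Psi q) <-> p = q \/ adjacent p q.
Proof.
rewrite adjacent_near; split=> [npq|[->|[]//]]; last exact: near_refl.
by have [/(@Psi_inj _ K)|] := pselect (Psi p = Psi q); [left|right].
Qed.

End Transfer.

(** * Bijections preserving distant points, adjacency or lines *)

Lemma distant_isomorphism_sym (R R' : pzRingType) (phi : projline R -> projline R') psi :
  cancel phi psi -> cancel psi phi -> distant_isomorphism phi -> distant_isomorphism psi.
Proof.
move=> phiK psiK [_ pq]; split; first by exists phi.
by move=> p q; rewrite pq !psiK.
Qed.

Lemma distant_isomorphism_parallel (R R' : pzRingType) (phi : projline R -> projline R') p q :
  distant_isomorphism phi -> parallel p q -> parallel (phi p) (phi q).
Proof.
move=> [[psi phiK psiK] dE] pq z; rewrite /distants /= -(psiK z) -!dE; exact: pq.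
Qed.

(** Adjacency is formulated through [distant] alone, and the inverse map preserves [distant] too. *)
Lemma distant_isomorphism_adjacent (R R' : pzRingType) (phi : projline R -> projline R') p q :
  distant_isomorphism phi -> adjacent p q -> adjacent (phi p) (phi q).
Proof.
move=> iso [r [rp rq cov]]; have [[psi phiK psiK] dE] := iso.
have iso' := distant_isomorphism_sym phiK psiK iso.
exists (phi r); split.
- by move=> /(distant_isomorphism_parallel iso'); rewrite !phiK.
- by move=> /(distant_isomorphism_parallel iso'); rewrite !phiK.
by move=> z; rewrite /distants /= -(psiK z) -!dE; apply: cov.
Qed.

Lemma distant_adjacent_isomorphism (R R' : pzRingType) (phi : projline R -> projline R') :
  distant_isomorphism phi -> adjacent_isomorphism phi.
Proof.
move=> iso; have [[psi phiK psiK] _] := iso; split; first by exists psi.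
have iso' := distant_isomorphism_sym phiK psiK iso.
move=> p q; split; first exact: distant_isomorphism_adjacent.
by move=> /(distant_isomorphism_adjacent iso'); rewrite !phiK.
Qed.

Lemma reach_homo (T T' : Type) (e : T -> T -> Prop) (e' : T' -> T' -> Prop) (f : T -> T') :
  (forall x y, e x y -> e' (f x) (f y)) ->
  forall k x y, reach e k x y -> reach e' k (f x) (f y).
Proof.
move=> ef; elim=> [|k IHk] x y /=; first by move=> ->.
by move=> [z /IHk xz /ef zy]; exists (f z).
Qed.

Section Morphisms.
Variables (I J : finType) (K : I -> unitRingType) (K' : J -> unitRingType).
Variables (U : forall i, vectType (K i)) (U' : forall j, vectType (K' j)).
Hypotheses (i0 : I) (j0 : J).
Hypothesis K_div : forall i, GRing.field_axiom (K i).
Hypothesis K'_div : forall j, GRing.field_axiom (K' j).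
Hypothesis U_gt0 : forall i, (0 < dim (U i))%N.
Hypothesis U'_gt0 : forall j, (0 < dim (U' j))%N.
Local Notation M := (product_space U).
Local Notation M' := (product_space U').

(** A line is the hull of two of its points, and [f] maps it onto the hull of their images, which is
    the line joining these. *)
Lemma near_isomorphism_line (f : points M -> points M') (g : points M' -> points M) :
  cancel f g -> cancel g f -> (forall X Y, near X Y <-> near (f X) (f Y)) ->
  forall L, lines L -> lines (f @` L).
Proof.
move=> fK gK fE L hL.
have [X [Y [LX LY XY]]] := product_line_nontrivial K_div U_gt0 hL.
have fXY : f X <> f Y by move=> /(can_inj fK).
have := line_near K_div U_gt0 hL LX LY; rewrite fE.
move=> /(near_line K'_div U'_gt0 fXY)[L' [hL' LX' LY']].
suff -> : f @` L = L' by [].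
rewrite (product_line_hull i0 K_div U_gt0 hL LX LY XY).
rewrite (product_line_hull j0 K'_div U'_gt0 hL' LX' LY' fXY).
apply/seteqP; split=> [_ [Z ZXY <-] W|Z ZXY].
  by rewrite -(gK W) -!fE; apply: ZXY.
exists (g Z) => // W; rewrite !fE gK; exact: ZXY.
Qed.

Lemma line_homo_near (f : points M -> points M') :
  (forall L, lines L -> lines (f @` L)) -> forall X Y, near X Y -> near (f X) (f Y).
Proof.
move=> fL X Y nXY; have [->|XY] := pselect (X = Y); first exact: near_refl.
have [L [/fL hL LX LY]] := near_line K_div U_gt0 XY nXY.
by apply: (line_near K'_div U'_gt0 hL); [exists X|exists Y].
Qed.

End Morphisms.

Theorem proposition6p6 (m m' : nat) (m_gt0 : (0 < m)%N) (m'_gt0 : (0 < m')%N)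
    (K : 'I_m -> unitRingType) (K' : 'I_m' -> unitRingType)
    (K_div : forall i, GRing.field_axiom (K i))
    (K'_div : forall j, GRing.field_axiom (K' j))
    (U : forall i, vectType (K i)) (U' : forall j, vectType (K' j))
    (U_gt0 : forall i, (0 < dim (U i))%N) (U'_gt0 : forall j, (0 < dim (U' j))%N)
    (phi : projline (prodring (fun i => endo (U i))) ->
           projline (prodring (fun j => endo (U' j)))) :
  [<-> distant_isomorphism phi;
       adjacent_isomorphism phi;
       collineation (M := product_space U) (M' := product_space U')
         (fun X => Psi (phi (Psi_inv K_div X)))].
Proof.
have i0 := Ordinal m_gt0; have j0 := Ordinal m'_gt0.
pose f (X : points (product_space U)) := Psi (phi (Psi_inv K_div X)).
rewrite -/f; tfae.
- exact: distant_adjacent_isomorphism.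
- move=> [[psi phiK psiK] aE].
  pose g (Y : points (product_space U')) := Psi (psi (Psi_inv K'_div Y)).
  have fK : cancel f g by move=> X; rewrite /f /g PsiK phiK Psi_invK.
  have gK : cancel g f by move=> Y; rewrite /f /g PsiK psiK Psi_invK.
  (* Nearness is adjacency or equality, and [phi] preserves both in both directions. *)
  have fE X Y : near X Y <-> near (f X) (f Y).
    rewrite /f -[X in near X _](Psi_invK K_div) -[Y in near _ Y](Psi_invK K_div).
    rewrite (near_adjacent i0 K_div U_gt0) (near_adjacent j0 K'_div U'_gt0) aE.
    by split=> -[E|]; [left; rewrite E|right|left; apply: (can_inj phiK)|right].
  exists g; split=> //; first exact: (near_isomorphism_line i0 j0 K_div K'_div U_gt0 U'_gt0 fK gK).
  apply: (near_isomorphism_line j0 i0 K'_div K_div U'_gt0 U_gt0 gK fK) => X Y.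
  by rewrite fE !gK.
move=> [g [fK gK fL gL]].
have fPsi p : f (Psi p) = Psi (phi p) by rewrite /f PsiK.
split.
  exists (fun q => Psi_inv K_div (g (Psi q))) => [p|q]; first by rewrite -fPsi fK PsiK.
  by apply: (@Psi_inj _ K'); rewrite -[RHS]gK -fPsi Psi_invK.
(* Distant points become opposite points, and these are described by walks, which [f] and [g] map to
   walks of the same length. *)
move=> p q; rewrite (distant_opposite K_div) (distant_opposite K'_div) -!fPsi.
rewrite (opposite_reach i0 K_div U_gt0) (opposite_reach j0 K'_div U'_gt0).
have fR := reach_homo (line_homo_near j0 K_div K'_div U_gt0 U'_gt0 fL).
have gR := reach_homo (line_homo_near i0 K'_div K_div U'_gt0 U_gt0 gL).
split=> pq k r A B.
  by rewrite -[A]gK -[B]gK; apply: fR; apply: pq; have := gR _ _ _ r; rewrite !fK.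
by rewrite -[A]fK -[B]fK; apply: gR; apply: pq; apply: fR.
Qed.
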